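(* There exist absolute constants $C,c>0$ such that the following holds. Let $G:\mathbb{R}^k\to\mathbb{R}^n$ be a feedforward neural network of depth $d$ with only ReLU activations and at most $c_0\ge 2$ nodes in each layer. Let $\alpha\in(0,1)$, let $l\le n$ be a positive integer, $\epsilon_{\max}\ge0$ and $\delta\ge0$. Let $A\in\mathbb{R}^{m\times n}$ have i.i.d. entries $A_{ij}\sim\mathcal{N}(0,1/m)$ with $$m\ge\frac{C}{\alpha^2}\Big((k+l)\,d\log c_0+(k+l)\log(n/l)\Big).$$ Then with probability at least $1-e^{-c\alpha^2m}$ there exists a decoder $\Delta:\mathbb{R}^m\to\mathbb{R}^n$ such that for all $x\in\mathbb{R}^n$ and all $\epsilon\in\mathbb{R}^m$ with $\|\epsilon\|_2\le\epsilon_{\max}$, $$\|x-\Delta(Ax+\epsilon)\|_2\le(2l)^{-1/2}C_0\,\sigma_{l,G}(x)+C_1\epsilon_{\max}+\delta',$$ where $C_0=2\big((1+\alpha)(1-\alpha)^{-1}+1\big)$, $C_1=2(1-\alpha)^{-1}$, $\delta'=\delta(1-\alpha)^{-1}$.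
   Context: A depth-$d$ ReLU network is a map $G(z)=W_d\,\mathrm{ReLU}(W_{d-1}\cdots\mathrm{ReLU}(W_1z+b_1)\cdots+b_{d-1})+b_d$ with affine layers and coordinatewise $\mathrm{ReLU}(t)=\max(t,0)$; ''at most $c_0$ nodes per layer'' means each intermediate layer has dimension at most $c_0$. For $v\in\mathbb{R}^n$ and $s\ge0$, $S_s(v)=\{x\in\mathbb{R}^n:\|x-v\|_0\le s\}$, where $\|\cdot\|_0$ counts nonzero coordinates. $S_{s,G}=\bigcup_{z\in\mathbb{R}^k}S_s(G(z))$, and $\sigma_{l,G}(x)=\inf_{\hat x\in S_{l,G}}\|x-\hat x\|_1$. *)

(* Defs.v *)
From HB Require Import structures.
From mathcomp Require Import all_boot all_order all_algebra.
From mathcomp Require Import all_classical all_reals all_analysis.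
Set Implicit Arguments. Unset Strict Implicit. Unset Printing Implicit Defensive.
Import Order.TTheory GRing.Theory Num.Theory.
Local Open Scope classical_set_scope.
Local Open Scope ring_scope.

Section Defs.
Variable R : realType.

Definition relu_vec h (v : 'cV[R]_h) : 'cV[R]_h := map_mx (fun t => Num.max t 0) v.

(* A ReLU network R^k -> R^n: a nonempty list of affine layers, with ReLU
   applied after every layer except the last one. *)
Inductive relu_net : nat -> nat -> Type :=
| RN_out (k n : nat) : 'M[R]_(n, k) -> 'cV[R]_n -> relu_net k n
| RN_hidden (k h n : nat) : 'M[R]_(h, k) -> 'cV[R]_h -> relu_net h n -> relu_net k n.

Fixpoint net_eval k n (N : relu_net k n) : 'cV[R]_k -> 'cV[R]_n :=
  match N in relu_net k n return 'cV[R]_k -> 'cV[R]_n with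
  | RN_out _ _ W b => fun z => W *m z + b
  | RN_hidden _ _ _ W b N' => fun z => net_eval N' (relu_vec (W *m z + b))
  end.

Fixpoint net_depth k n (N : relu_net k n) : nat :=
  match N with
  | RN_out _ _ _ _ => 1
  | RN_hidden _ _ _ _ _ N' => (net_depth N').+1
  end.

Fixpoint net_width_le k n (c0 : nat) (N : relu_net k n) : bool :=
  match N with
  | RN_out _ _ _ _ => true
  | RN_hidden _ h _ _ _ N' => (h <= c0)%N && net_width_le c0 N'
  end.

Definition is_relu_net k n (d c0 : nat) (G : 'cV[R]_k -> 'cV[R]_n) : Prop :=
  exists N : relu_net k n,
    net_depth N = d /\ net_width_le c0 N /\ forall z, G z = net_eval N z.

Definition l0norm n (x : 'cV[R]_n) : nat := #|[set i | x i 0 != 0]|.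
Definition l1norm n (x : 'cV[R]_n) : R := \sum_i `|x i 0|.
Definition l2norm n (x : 'cV[R]_n) : R := Num.sqrt (\sum_i (x i 0) ^+ 2).

Definition S_s n (s : nat) (v : 'cV[R]_n) : set 'cV[R]_n :=
  [set x | (l0norm (x - v) <= s)%N].
Definition S_sG k n (s : nat) (G : 'cV[R]_k -> 'cV[R]_n) : set 'cV[R]_n :=
  [set x | exists z, S_s s (G z) x].
Definition sigma_lG k n (l : nat) (G : 'cV[R]_k -> 'cV[R]_n) (x : 'cV[R]_n) : R :=
  inf [set l1norm (x - xh) | xh in S_sG l G].

End Defs.

Definition mutually_independent d (T : measurableType d) (R : realType)
  (P : probability T R) (I : finType) (Y : I -> T -> R) : Prop :=
  forall B : I -> set R, (forall i, measurable (B i)) ->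
    P (\bigcap_i (Y i @^-1` B i)) = (\prod_(i : I) P (Y i @^-1` B i))%E.

Definition rand_mx d (T : measurableType d) (R : realType) m n
  (X : 'I_m -> 'I_n -> T -> R) (w : T) : 'M[R]_(m, n) :=
  \matrix_(i, j) X i j w.

(* Main.v *)
Require Import Defs.
From HB Require Import structures.
From mathcomp Require Import all_boot all_order all_algebra.
From mathcomp Require Import all_classical all_reals all_analysis.
From mathcomp Require Import measurable_realfun.
From mathcomp Require Import ring lra zify.

Set Implicit Arguments.
Unset Strict Implicit.
Unset Printing Implicit Defensive.

Import Order.TTheory GRing.Theory Num.Theory.
Import numFieldNormedType.Exports.
Local Open Scope classical_set_scope.
Local Open Scope ring_scope.

(** A matrix [A] with [| |A u|^2 - |u|^2 | <= alpha |u|^2] for every [u] of the form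
    [G z - G z' + v] with [v] of sparsity [4 l] satisfies the instance optimality
    inequality
    [|x1 - x2| <= C0 / 2 (2 l)^(-1/2) (sigma x1 + sigma x2) + |A (x1 - x2)| / (1 - alpha)],
    by cutting the part of [x1 - x2] far from the model into blocks of its [2 l] largest
    entries.  Minimizing [sigma] over the signals consistent with the measurements is then
    the decoder; the minimum is attained since that inequality bounds the sublevel sets.

    Such an [A] exists with high probability.  Adding one hyperplane at a time shows that a
    layer has at most [(c0 + 1)^k] activation patterns on [R^k], so the vectors [u] lie in
    few subspaces of dimension [O(k + l)].  On each of them a quadratic form is controlled
    by its values on a grid of [2^O(k + l)] points, where the number of points does not
    depend on [alpha]; it remains to take a union bound over a chi-square tail estimate. *)

(** * Quadratic forms on a grid *)

(** A net argument for the norm [|A u|] would need accuracy [alpha], hence about [log (1 / alpha)]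
    times the dimension in the exponent of the union bound, more than the stated [m] allows. For the
    quadratic form [|A u|^2 - |u|^2], polarization gives a self-improving inequality: a net of fixed
    accuracy loses only a factor 2, so testing at level [alpha / 2] suffices. The test vectors are
    fixed before [A] is drawn. The event of the theorem is the finite set of test conditions on [A],
    which makes it measurable; everything from there to the decoder is deterministic and done for
    each such [A]. *)

Section euclidean.
Variable R : realType.

Definition dot n (u v : 'cV[R]_n) : R := (u^T *m v) 0 0.

Lemma dotE n (u v : 'cV[R]_n) : dot u v = \sum_i u i 0 * v i 0.
Proof. by rewrite /dot mxE; apply: eq_bigr => i _; rewrite mxE. Qed.

Lemma dotC n (u v : 'cV[R]_n) : dot u v = dot v u.
Proof. by rewrite !dotE; apply: eq_bigr => i _; rewrite mulrC. Qed.

Lemma dotDr n (u v w : 'cV[R]_n) : dot u (v + w) = dot u v + dot u w.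
Proof. by rewrite /dot mulmxDr mxE. Qed.

Lemma dotDl n (u v w : 'cV[R]_n) : dot (u + v) w = dot u w + dot v w.
Proof. by rewrite dotC dotDr !(dotC w). Qed.

Lemma dotNr n (u v : 'cV[R]_n) : dot u (- v) = - dot u v.
Proof. by rewrite /dot mulmxN mxE. Qed.

Lemma dotNl n (u v : 'cV[R]_n) : dot (- u) v = - dot u v.
Proof. by rewrite dotC dotNr dotC. Qed.

Lemma dotZr n (a : R) (u v : 'cV[R]_n) : dot u (a *: v) = a * dot u v.
Proof. by rewrite /dot -scalemxAr mxE. Qed.

Lemma dotZl n (a : R) (u v : 'cV[R]_n) : dot (a *: u) v = a * dot u v.
Proof. by rewrite dotC dotZr dotC. Qed.

Lemma dot_mulmxl m n (A : 'M[R]_(m, n)) (u : 'cV[R]_n) (v : 'cV[R]_m) :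
  dot (A *m u) v = dot u (A^T *m v).
Proof. by rewrite /dot trmx_mul mulmxA. Qed.

Lemma dot_ge0 n (u : 'cV[R]_n) : 0 <= dot u u.
Proof. by rewrite dotE sumr_ge0 // => i _; rewrite -expr2 sqr_ge0. Qed.

Lemma dot_eq0 n (u : 'cV[R]_n) : dot u u = 0 -> u = 0.
Proof.
rewrite dotE => /eqP; rewrite psumr_eq0 => [/allP h|i _]; last first.
  by rewrite -expr2 sqr_ge0.
apply/colP => i; have := h i (mem_index_enum i).
by rewrite mulf_eq0 orbb mxE => /eqP.
Qed.

Lemma parallelogram n (u v : 'cV[R]_n) :
  dot (u + v) (u + v) + dot (u - v) (u - v) = 2 * (dot u u + dot v v).
Proof. by rewrite !(dotDl, dotDr, dotNl, dotNr); ring. Qed.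

Lemma l2normE n (u : 'cV[R]_n) : l2norm u = Num.sqrt (dot u u).
Proof. by rewrite /l2norm dotE. Qed.

Lemma sqr_l2norm n (u : 'cV[R]_n) : l2norm u ^+ 2 = dot u u.
Proof. by rewrite l2normE sqr_sqrtr ?dot_ge0. Qed.

Lemma l2norm_ge0 n (u : 'cV[R]_n) : 0 <= l2norm u.
Proof. exact: sqrtr_ge0. Qed.

Lemma l2normN n (u : 'cV[R]_n) : l2norm (- u) = l2norm u.
Proof. by rewrite !l2normE dotNl dotNr opprK. Qed.

Lemma l2norm0 n : l2norm (0 : 'cV[R]_n) = 0.
Proof. by rewrite l2normE /dot mulmx0 mxE sqrtr0. Qed.

Lemma sqr_dot_le n (u v : 'cV[R]_n) : dot u v ^+ 2 <= dot u u * dot v v.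
Proof.
have [v0|v_neq0] := eqVneq (dot v v) 0.
  by rewrite (dot_eq0 v0) /dot !mulmx0 mxE expr0n mulr0.
have v_gt0 : 0 < dot v v by rewrite lt0r v_neq0 dot_ge0.
have := dot_ge0 (dot v v *: u - dot u v *: v).
rewrite !(dotDl, dotDr, dotNl, dotNr, dotZl, dotZr) (dotC v u) => h.
rewrite -subr_ge0 -(pmulr_rge0 _ v_gt0).
by apply: le_trans h _; rewrite le_eqVlt; apply/orP; left; apply/eqP; ring.
Qed.

Lemma dot_le n (u v : 'cV[R]_n) : dot u v <= l2norm u * l2norm v.
Proof.
rewrite !l2normE -sqrtrM ?dot_ge0 //; apply: le_trans (ler_norm _) _.
by rewrite -sqrtr_sqr ler_wsqrtr // sqr_dot_le.
Qed.

Lemma l2normD n (u v : 'cV[R]_n) : l2norm (u + v) <= l2norm u + l2norm v.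
Proof.
rewrite -(@ler_pXn2r _ 2) ?nnegrE ?addr_ge0 ?l2norm_ge0 //.
rewrite sqr_l2norm !dotDl !dotDr sqrrD !sqr_l2norm (dotC v u).
by have := dot_le u v; lra.
Qed.

Lemma l2norm_sum n (ws : seq 'cV[R]_n) :
  l2norm (\sum_(w <- ws) w) <= \sum_(w <- ws) l2norm w.
Proof.
elim: ws => [|w ws IH]; first by rewrite !big_nil l2norm0.
by rewrite !big_cons (le_trans (l2normD _ _)) // lerD2l.
Qed.

(* Gram-Schmidt; a column of [B] depending on the previous ones yields a zero
   column of [Q], so [Q] is only a partial isometry. *)
Lemma partial_isometry_range n D (B : 'M[R]_(n, D)) :
  exists Q : 'M[R]_(n, D), Q *m Q^T *m Q = Q /\ Q *m Q^T *m B = B.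
Proof.
elim: D B => [|D IH] B.
  by exists 0; split; apply/matrixP => i [].
suff step (B' : 'M[R]_(n, 1 + D)) :
    exists Q : 'M[R]_(n, 1 + D), Q *m Q^T *m Q = Q /\ Q *m Q^T *m B' = B'.
  exact: step.
have {B} [Q [QQ QB]] := IH (rsubmx B').
pose b := lsubmx B'; pose w := b - Q *m Q^T *m b.
have Qw : Q^T *m w = 0.
  have QtQ : Q^T *m (Q *m Q^T) = Q^T.
    by rewrite -[RHS](congr1 trmx QQ) !trmx_mul trmxK mulmxA.
  by rewrite /w mulmxBr mulmxA QtQ subrr.
have wQ : w^T *m Q = 0 by rewrite -[LHS]trmxK trmx_mul trmxK Qw trmx0.
(* It remains to normalize the residual [w], with [q = 0] when it vanishes; [q *m q^T *m b = w]
   holds because [b - w] lies in the range of [Q], to which [w] is orthogonal. *)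
suff [q [qq [Qq [qQ qb]]]] : exists q : 'cV[R]_n, q *m q^T *m q = q /\
    Q^T *m q = 0 /\ q^T *m Q = 0 /\ q *m q^T *m b = w.
  exists (row_mx q Q).
  have E : row_mx q Q *m (row_mx q Q)^T = q *m q^T + Q *m Q^T.
    by rewrite tr_row_mx mul_row_col.
  rewrite E; split.
    rewrite mul_mx_row !mulmxDl qq QQ -!mulmxA Qq qQ !mulmx0 addr0 add0r.
    by [].
  rewrite -[B']hsubmxK mul_mx_row !mulmxDl qb QB -/b /w subrK.
  by rewrite -{1}QB -!mulmxA (mulmxA q^T Q) qQ mul0mx mulmx0 add0r.
have [w0|wn0] := eqVneq w 0.
  by exists 0; rewrite !(mul0mx, mulmx0, trmx0) w0.
have w_gt0 : 0 < dot w w.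
  by rewrite lt0r dot_ge0 andbT; apply: contra_neq wn0; exact: dot_eq0.
pose a := Num.sqrt (dot w w).
have a0 : a != 0 by rewrite gt_eqF // sqrtr_gt0.
have aa : a ^+ 2 = dot w w by rewrite sqr_sqrtr ?dot_ge0.
have ww : w^T *m w = (a ^+ 2)%:M.
  by rewrite aa /dot [LHS]mx11_scalar.
have wb : w^T *m b = (a ^+ 2)%:M.
  by rewrite -ww [in RHS]/w mulmxBr !mulmxA wQ !mul0mx subr0.
have et : (a^-1 *: w)^T = a^-1 *: w^T by rewrite linearZ.
exists (a^-1 *: w); rewrite et -!mulmxA; split; last split; last split.
- rewrite -[a^-1 *: w^T *m _]scalemxAl -[w^T *m _]scalemxAr ww !scale_scalar_mx.
  by rewrite mul_mx_scalar scalerA; congr (_ *: _); field.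
- by rewrite -scalemxAr Qw scaler0.
- by rewrite -scalemxAl wQ scaler0.
- rewrite -[a^-1 *: w^T *m _]scalemxAl wb scale_scalar_mx mul_mx_scalar.
  by rewrite scalerA -[RHS]scale1r; congr (_ *: _); field.
Qed.

(** [Q^T *m Q] is an orthogonal projection, so the difference of the two sides is the squared norm
    of [y - Q^T *m (Q *m y)]. *)
Lemma partial_isometry_le n D (Q : 'M[R]_(n, D)) (y : 'cV[R]_D) :
  Q *m Q^T *m Q = Q -> dot (Q *m y) (Q *m y) <= dot y y.
Proof.
move=> QQ; have QQy : Q *m (Q^T *m (Q *m y)) = Q *m y by rewrite !mulmxA QQ.
have := dot_ge0 (y - Q^T *m (Q *m y)).
rewrite !(dotDl, dotDr, dotNl, dotNr) (dotC y) !dot_mulmxl trmxK.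
by rewrite QQy; lra.
Qed.

(** A mesh of [1 / (4 sqrt D)] makes rounding a unit vector cost at most [1 / 16] in squared norm.
    Magnitudes and signs are stored apart so that the magnitudes can be counted as tuples of bounded
    sum. *)
Definition grid_point D (p : D.-tuple 'I_(16 * D).+1 * {set 'I_D}) : 'cV[R]_D :=
  \col_i ((-1) ^+ (i \in p.2) * (tnth p.1 i : nat)%:R / (4 * Num.sqrt D%:R)).

(** The bound [16 D] on the sum of the integer magnitudes keeps every rounding of a unit vector,
    since [z <= z^2] for a natural number [z]. It also keeps the count exponential in [D], whereas a
    cube of magnitudes would give [D^O(D)] points. *)
Definition grid D : seq 'cV[R]_D :=
  [seq grid_point p | p <- enum
     (finset.setX
        [set t : D.-tuple 'I_(16 * D).+1 | (\sum_(i <- t) i <= 16 * D)%N]%SET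
        [set: {set 'I_D}]%SET)].

(** Stars and bars counts the magnitudes by a binomial coefficient with top [17 D], at most
    [2^(17 D)]; the signs contribute [2^D]. *)
Lemma size_grid D : (size (grid D) <= 2 ^ (18 * D))%N.
Proof.
rewrite size_map -cardE cardsX card_partial_ord_partitions.
rewrite -powersetT card_powerset cardsT card_ord.
have bin_le2X a b : ('C(a, b) <= 2 ^ a)%N.
  elim: a b => [|a IH] [|b]; rewrite ?bin0 ?expn_gt0 //.
  by rewrite binS expnS mul2n -addnn leq_add.
apply: leq_trans (leq_mul (bin_le2X _ _) (leqnn _)) _.
by rewrite -expnD leq_exp2l //; lia.
Qed.

Lemma grid_dense D (x : 'cV[R]_D) : dot x x = 1 ->
  exists2 y, y \in grid D & dot y y <= 1 /\ dot (x - y) (x - y) <= 1 / 16.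
Proof.
move=> xx.
have D0 : (0 < D)%N.
  by case: D x xx => // x; rewrite dotE big_ord0 => /esym/eqP; rewrite oner_eq0.
have DR : (0 : R) < D%:R by rewrite ltr0n.
pose M := 4 * Num.sqrt D%:R : R.
have M0 : 0 < M by rewrite mulr_gt0 // sqrtr_gt0.
have MM : M ^+ 2 = 16 * D%:R.
  by rewrite exprMn sqr_sqrtr ?ler0n // -natrX.
(* Rounding magnitudes down, rather than to the nearest integer, guarantees [|y| <= |x|]. *)
pose z (i : 'I_D) := Num.truncn (M * `|x i 0|).
have Mx i : 0 <= M * `|x i 0| by rewrite mulr_ge0 // ltW.
have zle i : (z i)%:R <= M * `|x i 0|.
  by have /andP[] := truncn_itv (Mx i).
have zge i : M * `|x i 0| <= (z i)%:R + 1.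
  by have /andP[_ /ltW] := truncn_itv (Mx i); rewrite -natr1.
have zsum : (\sum_i z i <= 16 * D)%N.
  rewrite -(@ler_nat R) natrM -MM -[leRHS]mulr1 -[X in _ <= _ * X]xx dotE mulr_sumr natr_sum.
  apply: ler_sum => i _; apply: (@le_trans _ _ ((z i)%:R ^+ 2)).
    by rewrite -natrX ler_nat; case: (z i) => // j; rewrite leq_pmulr.
  rewrite -expr2 -exprMn -(real_normK (num_real (M * _))) normrM (gtr0_norm M0).
  by rewrite ler_pXn2r ?nnegrE ?ler0n.
have zlt i : (z i < (16 * D).+1)%N.
  by rewrite ltnS (leq_trans _ zsum) // (bigD1 i) //= leq_addr.
pose t : D.-tuple 'I_(16 * D).+1 := [tuple Ordinal (zlt i) | i < D].
pose J := [set i | x i 0 < 0]%SET.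
pose y := grid_point (t, J).
have yE i : y i 0 = (-1) ^+ (x i 0 < 0)%R * (z i)%:R / M.
  by rewrite mxE /= tnth_mktuple inE.
clearbody M.
have sgx i : x i 0 = (-1) ^+ (x i 0 < 0)%R * `|x i 0| by rewrite -realEsign ?num_real.
exists y.
  apply/mapP; exists (t, J) => //; rewrite mem_enum !inE andbT /=.
  by rewrite big_map big_enum.
split.
  rewrite -[leRHS]xx !dotE; apply: ler_sum => i _; rewrite -!expr2 yE.
  rewrite !exprMn sqrr_sign mul1r exprVn ler_pdivrMr ?exprn_gt0 //.
  rewrite -exprMn -(real_normK (num_real (x i 0 * _))) normrM (gtr0_norm M0).
  by rewrite ler_pXn2r ?nnegrE ?ler0n // mulrC.
apply: (@le_trans _ _ (\sum_(i < D) (M ^+ 2)^-1)); last first.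
  rewrite sumr_const card_ord -mulr_natl MM le_eqVlt; apply/orP; left; apply/eqP.
  by field; rewrite gt_eqF.
rewrite dotE; apply: ler_sum => i _; rewrite -expr2.
have -> : (x - y) i 0 = (-1) ^+ (x i 0 < 0)%R * ((M * `|x i 0| - (z i)%:R) / M).
  rewrite 2!mxE {1}sgx yE mulrBl (mulrC M) mulfK ?gt_eqF //; ring.
rewrite !exprMn sqrr_sign mul1r exprVn ler_pdivrMr ?exprn_gt0 //.
rewrite mulVf ?gt_eqF ?exprn_gt0 // expr_le1 //.
  by rewrite lerBlDl.
by rewrite subr_ge0.
Qed.

(* If [|q| <= s |.|^2] everywhere, then for a unit vector [x] and its net
   approximation [y], polarization bounds [q x - q y = b (x - y) (x + y)] by
   [s / 2]; so [s] may be replaced by [t + s / 2], whose fixed point is [2 t]. *)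
Lemma quadratic_form_le_of_grid D (B : 'M[R]_D) (t : R) : B^T = B -> 0 <= t ->
  (forall y, y \in grid D -> `|dot y (B *m y)| <= t * dot y y) ->
  forall x, `|dot x (B *m x)| <= 2 * t * dot x x.
Proof.
move=> Bsym t0 Bgrid.
pose q (x : 'cV[R]_D) := dot x (B *m x).
pose b (x y : 'cV[R]_D) := dot x (B *m y).
have bC x y : b x y = b y x by rewrite /b -{1}Bsym -dot_mulmxl dotC.
pose S := [set s : R | 0 <= s /\ forall x, `|q x| <= s * dot x x].
have S_step s : S s -> S (t + s / 2).
  move=> [s0 hs]; split; first by lra.
  move=> x; have [x0|xn0] := eqVneq (dot x x) 0.
    by rewrite (dot_eq0 x0) /q /dot !mulmx0 mxE normr0 mulr0.
  have x_gt0 : 0 < dot x x by rewrite lt0r xn0 dot_ge0.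
  wlog x1 : x xn0 x_gt0 / dot x x = 1 => [h|].
    pose a := Num.sqrt (dot x x).
    have a0 : 0 < a by rewrite sqrtr_gt0.
    have aa : a ^+ 2 = dot x x by rewrite sqr_sqrtr ?dot_ge0.
    have e : dot (a^-1 *: x) (a^-1 *: x) = 1.
      by rewrite dotZl dotZr -aa; field; rewrite gt_eqF.
    have := h (a^-1 *: x); rewrite e oner_neq0 ltr01 => /(_ isT isT erefl).
    rewrite /q -scalemxAr dotZl dotZr mulrA normrM ger0_norm; last first.
      by rewrite mulr_ge0 // invr_ge0 ltW.
    by rewrite -invfM -expr2 aa mulr1 mulrC ler_pdivrMr.
  have [y yN [yy xy]] := grid_dense x1.
  have qB : q x - q y = b (x - y) (x + y).
    rewrite /q /b mulmxDr !(dotDl, dotDr, dotNl, dotNr).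
    by rewrite -!/(b _ _) (bC y x) /b; ring.
  have pol u v : 4 * b u v = q (u + v) - q (u - v).
    rewrite /q !(mulmxDr, mulmxN, dotDl, dotDr, dotNl, dotNr).
    by rewrite -!/(b _ _) (bC v u) /b; ring.
  have bb u v : `|b u v| <= s / 2 * (8 * dot u u + dot v v / 8).
    (* the weights 8 and 1/8 come from [b (a u) (v / a)] with [a^2 = 8] *)
    pose a := Num.sqrt 8 : R.
    have a0 : 0 < a by rewrite sqrtr_gt0.
    have aa : a ^+ 2 = 8 by rewrite sqr_sqrtr.
    have -> : b u v = b (a *: u) (a^-1 *: v).
      by rewrite /b -scalemxAr dotZl dotZr mulrA divff ?mul1r ?gt_eqF.
    have h1 := hs (a *: u + a^-1 *: v); have h2 := hs (a *: u - a^-1 *: v).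
    have := le_trans (ler_normB _ _) (lerD h1 h2); rewrite -pol normrM ger0_norm //.
    rewrite -mulrDr parallelogram !(dotZl, dotZr).
    have -> : a * (a * dot u u) = 8 * dot u u by rewrite mulrA -expr2 aa.
    have -> : a^-1 * (a^-1 * dot v v) = dot v v / 8.
      by rewrite mulrA -invfM -expr2 aa mulrC.
    by lra.
  have p4 : dot (x + y) (x + y) <= 4.
    by have := dot_ge0 (x - y); have := parallelogram x y; lra.
  have qy : `|q y| <= t.
    by apply: le_trans (Bgrid _ yN) _; rewrite -[leRHS]mulr1 ler_wpM2l.
  rewrite -(subrK (q y) (q x)) qB x1 mulr1 addrC.
  apply: le_trans (ler_normD _ _) _; apply: lerD => //.
  (* With [|x - y|^2 <= 1 / 16] and [|x + y|^2 <= 4] the two weighted terms are at most [1 / 2]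
     each. *)
  apply: le_trans (bb _ _) _; rewrite -[leRHS]mulr1; apply: ler_wpM2l; lra.
(* The sum of all [|B i j|] is a crude admissible constant; it provides the infimum on which the
   self-improving step acts. *)
have Sn0 : S !=set0.
  exists (\sum_i \sum_j `|B i j|); split.
    by apply: sumr_ge0 => i _; apply: sumr_ge0.
  move=> x; rewrite /q [dot x (B *m x)]dotE mulr_suml.
  apply: le_trans (ler_norm_sum _ _ _) _; apply: ler_sum => i _.
  rewrite mxE mulr_sumr mulr_suml.
  apply: le_trans (ler_norm_sum _ _ _) _; apply: ler_sum => j _.
  rewrite mulrCA normrM; apply: ler_wpM2l => //.
  have h k : x k 0 ^+ 2 <= dot x x.
    by rewrite dotE (bigD1 k) //= -expr2 lerDl sumr_ge0 // => l _; rewrite -expr2 sqr_ge0.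
  by have := h i; have := h j; rewrite ler_norml; nra.
have Slb : has_inf S by split => //; exists 0 => s [].
have infS0 : 0 <= inf S by apply: lb_le_inf => // s [].
have infS : inf S <= 2 * t.
  suff h : 2 * (inf S - t) <= inf S by lra.
  apply: lb_le_inf => // s Ss.
  by have := ge_inf Slb.2 (S_step s Ss); lra.
move=> x; rewrite -/(q x); apply: (@le_trans _ _ (inf S * dot x x)); last first.
  by rewrite ler_wpM2r ?dot_ge0.
have [x0|xn0] := eqVneq (dot x x) 0.
  by rewrite (dot_eq0 x0) /q /dot !mulmx0 mxE normr0 mulr0.
have x_gt0 : 0 < dot x x by rewrite lt0r xn0 dot_ge0.
rewrite -ler_pdivrMr //; apply: lb_le_inf => // s [_ hs].
by rewrite ler_pdivrMr.
Qed.

(** The form [|A u|^2 - |u|^2] is pulled back along [Q] to [D] coordinates. A partial isometry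
    suffices: [Q] does not increase the norm of grid points, and [Q^T] preserves the norm on the
    range of [Q]. *)
Lemma near_isometry_of_grid m n D (A : 'M[R]_(m, n)) (Q : 'M[R]_(n, D)) (t : R) :
  Q *m Q^T *m Q = Q -> 0 <= t ->
  (forall y, y \in [seq Q *m y | y <- grid D] ->
     `|dot (A *m y) (A *m y) - dot y y| <= t * dot y y) ->
  forall u, Q *m Q^T *m u = u ->
    `|dot (A *m u) (A *m u) - dot u u| <= 2 * t * dot u u.
Proof.
move=> QQ t0 hgrid u Qu.
pose B := Q^T *m (A^T *m A - 1%:M) *m Q.
have BE y : dot y (B *m y) = dot (A *m (Q *m y)) (A *m (Q *m y)) - dot (Q *m y) (Q *m y).
  rewrite (dot_mulmxl A) -dotNr -dotDr dot_mulmxl /B -!mulmxA mulmxBl mul1mx.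
  by rewrite !mulmxA.
have Bsym : B^T = B.
  by rewrite /B !trmx_mul trmxK linearB /= trmx_mul trmxK trmx1 mulmxA.
have hB y : y \in grid D -> `|dot y (B *m y)| <= t * dot y y.
  move=> yg; rewrite BE; apply: le_trans (hgrid _ (map_f _ yg)) _.
  by rewrite ler_wpM2l // partial_isometry_le.
have Qu' : Q *m (Q^T *m u) = u by rewrite mulmxA.
have := quadratic_form_le_of_grid Bsym t0 hB (Q^T *m u).
by rewrite BE Qu' [dot (Q^T *m u) _]dot_mulmxl trmxK Qu'.
Qed.

End euclidean.

(** * Affine pieces of a network *)

Lemma leq_exp2rW (a b e : nat) : (a <= b)%N -> (a ^ e <= b ^ e)%N.
Proof. by move=> ab; elim: e => // e IH; rewrite !expnS leq_mul. Qed.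

Section relu_pieces.
Variable R : realType.

Definition affine_eval k (f : 'rV[R]_k * R) (z : 'cV[R]_k) : R :=
  (f.1 *m z) 0 0 + f.2.

Definition sign_pattern k (fs : seq ('rV[R]_k * R)) (z : 'cV[R]_k) : seq bool :=
  [seq 0 < affine_eval f z | f <- fs].

Lemma affine_eval_conv k (f : 'rV[R]_k * R) (a : R) (y z : 'cV[R]_k) :
  affine_eval f (a *: y + (1 - a) *: z) =
  a * affine_eval f y + (1 - a) * affine_eval f z.
Proof. by rewrite /affine_eval mulmxDr -!scalemxAr !mxE; ring. Qed.

Lemma sign_pattern_conv k (fs : seq ('rV[R]_k * R)) (a : R) (y z : 'cV[R]_k) :
  0 <= a <= 1 -> sign_pattern fs y = sign_pattern fs z ->
  sign_pattern fs (a *: y + (1 - a) *: z) = sign_pattern fs z.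
Proof.
move=> /andP[a0 a1]; elim: fs => //= f fs IH [fE fsE]; rewrite IH //; congr (_ :: _).
rewrite affine_eval_conv; move: fE.
have [hy|hy] := ltP 0 (affine_eval f y); have [hz|hz] := ltP 0 (affine_eval f z) => // _.
  have [a_gt0|a_le0] := ltP 0 a; last first.
    have -> : a = 0 by lra.
    by apply/idP; lra.
  by apply: ltr_pwDl; rewrite ?mulr_gt0 // mulr_ge0 ?subr_ge0 // ltW.
by apply/negbTE; rewrite -leNgt; nra.
Qed.

Lemma hyperplane_parametrization k (f : 'rV[R]_k.+1 * R) : f.1 != 0 ->
  exists (M : 'M[R]_(k.+1, k)) (c : 'cV[R]_k.+1),
    forall z, affine_eval f z = 0 -> exists y, z = M *m y + c.
Proof.
case: f => w b /= wn0.
have [j wj] : exists j, w 0 j != 0.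
  apply/existsP; apply: contraNT wn0; rewrite negb_exists => /forallP h.
  by apply/eqP/rowP => j; rewrite mxE; apply/eqP; have := h j; rewrite negbK.
pose M : 'M[R]_(k.+1, k) := \matrix_(i, i')
  if i == j then - w 0 (lift j i') / w 0 j else (i == lift j i')%:R.
pose c : 'cV[R]_k.+1 := \col_i if i == j then - b / w 0 j else 0.
exists M, c => z; rewrite /affine_eval /= mxE (bigD1_ord j) //= => fz.
exists (\col_i z (lift j i) 0); apply/colP => i; rewrite !mxE.
have [->|ij] := eqVneq i j.
  under eq_bigr do rewrite !mxE eqxx mulrAC.
  rewrite -mulr_suml; under eq_bigr do rewrite mulNr; rewrite sumrN.
  apply: (mulfI wj); rewrite mulrDr !(mulrC (w 0 j) (_ / _)) !divfK //.
  by move/eqP: fz; rewrite -addrA addr_eq0 => /eqP ->; rewrite opprD.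
have [i' ->] : exists i', i = lift j i'.
  by case: (unliftP j i) ij => [i' -> _|->]; [exists i'|rewrite eqxx].
rewrite addr0 (bigD1 i') //= !mxE eq_sym (negbTE (neq_lift _ _)) eqxx mul1r.
rewrite big1 ?addr0 // => i2 ni; rewrite !mxE eq_sym (negbTE (neq_lift _ _)).
by rewrite (inj_eq lift_inj) eq_sym (negbTE ni) mul0r.
Qed.

(* A new hyperplane [f = 0] splits a pattern of the other functions only if that
   pattern is realized on the hyperplane, an affine space of dimension [k - 1]. *)
Lemma sign_patterns_count k (fs : seq ('rV[R]_k * R)) :
  exists2 s : seq (seq bool), (size s <= (size fs).+1 ^ k)%N &
    forall z, sign_pattern fs z \in s.
Proof.
move sz: (size fs) => h; elim: h k fs sz => [|h IH] k [|f fs] // => [_|[sz]].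
  by exists [:: [::]]; rewrite ?exp1n.
have [s ss hs] := IH k fs sz.
have [w0|wn0] := eqVneq f.1 0.
  exists [seq (0 < f.2) :: p | p <- s].
    by rewrite size_map (leq_trans ss) // leq_exp2rW.
  move=> z /=; rewrite /affine_eval w0 mul0mx mxE add0r.
  by rewrite map_f.
case: k f fs sz s ss hs wn0 => [|k] f fs sz s ss hs wn0.
  by case/eqP: wn0; apply/rowP => [[]].
have [M [c Mc]] := hyperplane_parametrization wn0.
pose gs := [seq (g.1 *m M, (g.1 *m c) 0 0 + g.2) | g <- fs].
have gsE y : sign_pattern gs y = sign_pattern fs (M *m y + c).
  rewrite /sign_pattern -map_comp; apply: eq_map => g /=.
  by rewrite /affine_eval /= mulmxDr mulmxA [in RHS]mxE addrA.
have [|s' ss' hs'] := IH k gs; first by rewrite size_map.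
(* Each old pattern gets one extension, negative if it occurs at all with [f <= 0]. The positive
   extension of such a pattern is listed only if the pattern occurs on the hyperplane: a segment
   joining points with [f <= 0] and [f > 0] keeps the pattern and crosses [f = 0]. *)
pose low p := `[< exists z, sign_pattern fs z = p /\ affine_eval f z <= 0 >].
exists ([seq ~~ low p :: p | p <- s] ++ [seq true :: p | p <- s']).
  (* [(h + 1)^(k + 1) + (h + 1)^k = (h + 2) (h + 1)^k <= (h + 2)^(k + 1)]. *)
  rewrite size_cat !size_map (leq_trans (leq_add ss ss')) //.
  by rewrite addnC expnS -mulSn [leqRHS]expnS leq_mul // leq_exp2rW.
move=> z; rewrite mem_cat /=.
have [fz|fz] := ltP 0 (affine_eval f z); last first.
  apply/orP; left; apply/mapP; exists (sign_pattern fs z) => //; congr (_ :: _).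
  by apply/esym/negbTE; rewrite negbK; apply/asboolP; exists z.
have [/asboolP [z' [zz' fz']]|nl] := boolP (low (sign_pattern fs z)); last first.
  by apply/orP; left; apply/mapP; exists (sign_pattern fs z) => //; rewrite nl.
apply/orP; right; apply/mapP; exists (sign_pattern fs z) => //.
pose a := affine_eval f z / (affine_eval f z - affine_eval f z').
have d0 : 0 < affine_eval f z - affine_eval f z' by lra.
have a01 : 0 <= a <= 1.
  by rewrite /a divr_ge0 ?(ltW fz) ?(ltW d0) //= ler_pdivrMr // mul1r; lra.
have f0 : affine_eval f (a *: z' + (1 - a) *: z) = 0.
  by rewrite affine_eval_conv /a; field; rewrite gt_eqF.
have [y zy] := Mc _ f0.
by rewrite -(sign_pattern_conv a01 zz') zy -gsE.
Qed.

Lemma net_depth_gt0 k n (N : relu_net R k n) : (0 < net_depth N)%N.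
Proof. by case: N. Qed.

(** Precomposing with an affine map from [R^p] keeps the original input as the variable throughout
    the induction. Each hidden layer then costs [(c0 + 1)^p], with the input dimension and not the
    layer width in the exponent. The last layer has no ReLU, hence [.-1]. *)
Lemma relu_net_pieces k n (N : relu_net R k n) (c0 p : nat)
    (W : 'M[R]_(k, p)) (b : 'cV[R]_k) : net_width_le c0 N ->
  exists2 s : seq ('M[R]_(n, p) * 'cV[R]_n),
    (size s <= (c0.+1 ^ p) ^ (net_depth N).-1)%N &
    forall z, exists2 q, q \in s & net_eval N (W *m z + b) = q.1 *m z + q.2.
Proof.
elim: N W b => [k' n' W1 b1|k' h n' W1 b1 N IH] W b /=.
  move=> _; exists [:: (W1 *m W, W1 *m b + b1)] => // z.
  by exists (W1 *m W, W1 *m b + b1); rewrite ?mem_head // mulmxDr mulmxA addrA.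
move=> /andP[hc0 wN].
pose W2 := W1 *m W; pose b2 := W1 *m b + b1.
pose fs := [seq (row i W2, b2 i 0) | i <- enum 'I_h].
have [s ss hs] := sign_patterns_count fs.
(* On a fixed activation pattern, ReLU acts as multiplication by this diagonal 0-1 matrix, so the
   layer merges into the affine map. *)
pose Dg (t : seq bool) : 'M[R]_h := diag_mx (\row_i (nth false t i)%:R).
have /choice [L HL] : forall t, exists s' : seq ('M[R]_(n', p) * 'cV[R]_n'),
    (size s' <= (c0.+1 ^ p) ^ (net_depth N).-1)%N /\
    forall z, exists2 q, q \in s' &
      net_eval N (Dg t *m W2 *m z + Dg t *m b2) = q.1 *m z + q.2.
  by move=> t; have [s' ? ?] := IH (Dg t *m W2) (Dg t *m b2) wN; exists s'.
have szL t : (size (L t) <= (c0.+1 ^ p) ^ (net_depth N).-1)%N by case: (HL t).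
exists (flatten [seq L t | t <- s]).
  rewrite -(ltn_predK (net_depth_gt0 N)) expnS.
  apply: (@leq_trans (size s * (c0.+1 ^ p) ^ (net_depth N).-1)).
    elim: (s) => //= t s' IHs; rewrite size_cat mulSn.
    by rewrite leq_add.
  by rewrite leq_mul // (leq_trans ss) // size_map size_enum_ord leq_exp2rW.
move=> z; set t := sign_pattern fs z.
have [_ /(_ z) [q qL qE]] := HL t.
exists q; first by apply/flatten_mapP; exists t => //; exact: hs.
rewrite -qE; congr net_eval; rewrite -mulmxA -mulmxDr.
have -> : W1 *m (W *m z + b) + b1 = W2 *m z + b2.
  by rewrite /W2 /b2 mulmxDr mulmxA addrA.
have tE (i : 'I_h) : nth false t i = (0 < (W2 *m z + b2) i 0).
  rewrite /t /sign_pattern /fs -map_comp (nth_map i) ?size_enum_ord //=.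
  by rewrite nth_ord_enum /affine_eval /= -row_mul !mxE.
move: (W2 *m z + b2) tE => v tE; apply/colP => i; rewrite mxE mul_diag_mx !mxE tE.
by case: ltP => _; rewrite ?mul1r ?mul0r.
Qed.

End relu_pieces.

(** Give each set [J] the weight [x^|J|] with [x = l / n <= 1]. The total weight is
    [(1 + x)^n <= e^l], and each counted set weighs at least [x^(4 l)]. *)
Lemma sparse_supports_le (R : realType) n l : (0 < l <= n)%N ->
  (#|[set J : {set 'I_n} | (#|J| <= 4 * l)%N]%SET|)%:R
    <= expR (4 * l%:R * ln (n%:R / l%:R) + l%:R) :> R.
Proof.
move=> /andP[l0 ln].
have n0 : (0 < n)%N by exact: leq_trans ln.
have lR : (0 : R) < l%:R by rewrite ltr0n.
have nR : (0 : R) < n%:R by rewrite ltr0n.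
pose x : R := l%:R / n%:R.
have x0 : 0 < x by rewrite divr_gt0.
have x1 : x <= 1 by rewrite ler_pdivrMr // mul1r ler_nat.
have sumx : \sum_(J : {set 'I_n}) x ^+ #|J| = (1 + x) ^+ n.
  rewrite addrC -[in RHS](card_ord n) -prodr_const (bigA_distr 1 _ (fun=> x)).
  by apply: eq_bigr => J _; rewrite -big_mkcond /= prodr_const.
have h : (#|[set J : {set 'I_n} | (#|J| <= 4 * l)%N]%SET|)%:R * x ^+ (4 * l)
    <= expR l%:R.
  apply: (@le_trans _ _ ((1 + x) ^+ n)); last first.
    have -> : l%:R = n%:R * x :> R by rewrite /x; field; rewrite gt_eqF.
    rewrite expRM_natl; apply: lerXn2r; rewrite ?nnegrE ?expR_ge0 ?expR_ge1Dx //.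
    by rewrite addr_ge0 // ltW.
  rewrite -sumx mulr_natl -sumr_const.
  rewrite [leRHS](bigID (mem [set J : {set 'I_n} | (#|J| <= 4 * l)%N]%SET)) /=.
  rewrite -[leLHS]addr0; apply: lerD; last first.
    by apply: sumr_ge0 => J _; rewrite exprn_ge0 // ltW.
  apply: ler_sum => J; rewrite inE => Jl.
  by apply: ler_wiXn2l => //; apply: ltW.
have xE : x ^+ (4 * l) = (expR (4 * l%:R * exp.ln (n%:R / l%:R)))^-1.
  by rewrite -natrM expRM_natl lnK ?posrE ?divr_gt0 // -exprVn invf_div.
by rewrite expRD -ler_pdivrMl ?expR_gt0 // -xE mulrC.
Qed.

(** * Recovery from near isometry *)

Section sparsity.
Variable R : realType.

Lemma l0normE n (x : 'cV[R]_n) : l0norm x = #|[set i | x i 0 != 0]%SET|.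
Proof. by apply: eq_card => i; rewrite !inE; apply/idP/idP; rewrite inE. Qed.

Lemma l0norm_le_supp n (x : 'cV[R]_n) (J : {set 'I_n}) :
  (forall i, i \notin J -> x i 0 = 0) -> (l0norm x <= #|J|)%N.
Proof.
move=> xJ; rewrite l0normE; apply/subset_leq_card/fintype.subsetP => i; rewrite inE.
by apply: contraR => /xJ ->.
Qed.

Lemma l0normD n (x y : 'cV[R]_n) : (l0norm (x + y) <= l0norm x + l0norm y)%N.
Proof.
rewrite (l0normE x) (l0normE y) (leq_trans _ (leq_card_setU _ _)) //.
apply: l0norm_le_supp => i; rewrite !inE negb_or !negbK => /andP[/eqP xi /eqP yi].
by rewrite mxE xi yi addr0.
Qed.

Lemma l0normN n (x : 'cV[R]_n) : l0norm (- x) = l0norm x.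
Proof. by rewrite !l0normE; apply: eq_card => i; rewrite !inE mxE oppr_eq0. Qed.

Lemma l1norm_ge0 n (x : 'cV[R]_n) : 0 <= l1norm x.
Proof. by apply: sumr_ge0. Qed.

Lemma l1normN n (x : 'cV[R]_n) : l1norm (- x) = l1norm x.
Proof. by apply: eq_bigr => i _; rewrite mxE normrN. Qed.

Lemma l1normD n (x y : 'cV[R]_n) : l1norm (x + y) <= l1norm x + l1norm y.
Proof. by rewrite -big_split; apply: ler_sum => i _; rewrite mxE ler_normD. Qed.

Definition restrict n (J : {set 'I_n}) (v : 'cV[R]_n) : 'cV[R]_n :=
  \col_i (if i \in J then v i 0 else 0).

Lemma l0norm_restrict n (J : {set 'I_n}) (v : 'cV[R]_n) :
  (l0norm (restrict J v) <= #|J|)%N.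
Proof. by apply: l0norm_le_supp => i /negbTE iJ; rewrite mxE iJ. Qed.

Lemma restrictK n (J : {set 'I_n}) (v : 'cV[R]_n) :
  restrict J v + restrict (~: J) v = v.
Proof.
by apply/colP => i; rewrite !mxE inE; case: (i \in J); rewrite ?addr0 ?add0r.
Qed.

Lemma l1norm_restrictK n (J : {set 'I_n}) (v : 'cV[R]_n) :
  l1norm (restrict J v) + l1norm (restrict (~: J) v) = l1norm v.
Proof.
rewrite -big_split; apply: eq_bigr => i _; rewrite !mxE inE.
by case: (i \in J); rewrite /= normr0 ?addr0 ?add0r.
Qed.

Lemma l1norm_restrict n (J : {set 'I_n}) (v : 'cV[R]_n) :
  l1norm (restrict J v) = \sum_(i in J) `|v i 0|.
Proof.
rewrite /l1norm [RHS]big_mkcond; apply: eq_bigr => i _; rewrite mxE.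
by case: (i \in J); rewrite ?normr0.
Qed.

Lemma largest_entries n (v : 'cV[R]_n) (K : {set 'I_n}) s : (s <= #|K|)%N ->
  exists J : {set 'I_n}, [/\ J \subset K, #|J| = s &
    forall i j, i \in J -> j \in K :\: J -> `|v j 0| <= `|v i 0|].
Proof.
elim: s => [|s IH] sK.
  by exists finset.set0; rewrite finset.sub0set cards0; split => // i j; rewrite inE.
have [J [JK Js hJ]] := IH (ltnW sK).
have [i0 i0K] : exists i0, i0 \in K :\: J.
  by apply/finset.set0Pn; rewrite -card_gt0 cardsD (finset.setIidPr JK) Js subn_gt0.
pose i1 := [arg max_(i > i0 | i \in K :\: J) `|v i 0|]%O.
have [i1K i1max] : i1 \in K :\: J /\ forall j, j \in K :\: J -> `|v j 0| <= `|v i1 0|.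
  by rewrite /i1; case: arg_maxP => // i iK hi; split.
move: (i1K); rewrite inE => /andP[i1J i1K'].
exists (i1 |: J); split.
- by apply/fintype.subsetP => i; rewrite !inE => /orP[/eqP ->//|]; move/fintype.subsetP: JK; exact.
- by rewrite cardsU1 i1J Js.
move=> i j; rewrite !inE negb_or => /orP[/eqP ->|iJ] /andP[/andP[ji jJ] jK].
  by apply: i1max; rewrite inE jJ.
by apply: hJ => //; rewrite inE jJ.
Qed.

(* Cutting [v] into blocks of its [s] largest remaining entries: each block has
   its entries below the average of the previous block. *)
Lemma block_decomposition n s (v : 'cV[R]_n) : (0 < s)%N ->
  exists (J : {set 'I_n}) (ws : seq 'cV[R]_n),
  [/\ (#|J| <= s)%N, forall w, w \in ws -> (l0norm w <= s)%N,
    v = restrict J v + \sum_(w <- ws) w &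
    \sum_(w <- ws) l2norm w <= (Num.sqrt s%:R)^-1 * l1norm v].
Proof.
move=> s0.
have sR : (0 : R) < s%:R by rewrite ltr0n.
have qs0 : (0 : R) < Num.sqrt s%:R by rewrite sqrtr_gt0.
(* Induction on a bound for the size of a set [K] supporting [v], which shrinks by [s] with each
   block. *)
suff : forall h (K : {set 'I_n}) (v : 'cV[R]_n), (#|K| <= h)%N ->
    (forall i, i \notin K -> v i 0 = 0) ->
  exists (J : {set 'I_n}) (ws : seq 'cV[R]_n),
  [/\ (#|J| <= s)%N, forall w, w \in ws -> (l0norm w <= s)%N,
    v = restrict J v + \sum_(w <- ws) w &
    \sum_(w <- ws) l2norm w <= (Num.sqrt s%:R)^-1 * l1norm v].
  by move=> /(_ #|[set: 'I_n]%SET| [set: 'I_n]%SET v); apply => // i; rewrite inE.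
elim=> [|h IH] K {}v Kh vK.
  exists finset.set0, [::]; rewrite cards0 !big_nil; split => //.
    apply/colP => i; rewrite !mxE inE addr0; apply: vK.
    by move: Kh; rewrite leqn0 cards_eq0 => /eqP ->; rewrite inE.
  by rewrite mulr_ge0 ?invr_ge0 ?l1norm_ge0 // ltW.
have [Ks|sK] := leqP #|K| s.
  exists K, [::]; rewrite !big_nil; split => //.
    apply/colP => i; rewrite !mxE addr0; case: ifPn => //; exact: vK.
  by rewrite mulr_ge0 ?invr_ge0 ?l1norm_ge0 // ltW.
have [J [JK Js hJ]] := largest_entries v (ltnW sK).
pose v' := restrict (~: J) v.
have v'K i : i \notin K :\: J -> v' i 0 = 0.
  rewrite !inE negb_and negbK !mxE !inE => /orP[->//|/vK ->]; exact: if_same.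
have Kh' : (#|K :\: J| <= h)%N.
  rewrite cardsD (finset.setIidPr JK) Js -ltnS (leq_trans _ Kh) //.
  by rewrite ltn_subrL s0 (leq_trans s0 (ltnW sK)).
have [J1 [ws [J1s wss v'E wsle]]] := IH _ v' Kh' v'K.
(* The head [J1] of the remainder, for which the induction hypothesis gives no norm bound, joins the
   tail and is charged to the [l1] norm of the block [J] removed here. *)
exists J, (restrict J1 v' :: ws); rewrite !big_cons -v'E restrictK Js; split => //.
  move=> w; rewrite inE => /orP[/eqP ->|/wss //].
  exact: leq_trans (l0norm_restrict _ _) J1s.
rewrite -(l1norm_restrictK J v) mulrDr; apply: lerD => //.
set a := l1norm (restrict J v).
have a0 : 0 <= a by exact: l1norm_ge0.
have v'le i : `|v' i 0| <= a / s%:R.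
  have [iK|iK] := boolP (i \in K :\: J); last first.
    by rewrite v'K // normr0 divr_ge0 // ltW.
  rewrite ler_pdivlMr // mulr_natr -Js -sumr_const /a l1norm_restrict.
  apply: ler_sum => j jJ; move: (hJ _ _ jJ iK); rewrite mxE.
  by case: ifP; rewrite ?normr0.
have -> : (Num.sqrt s%:R)^-1 * a = Num.sqrt (s%:R * (a / s%:R) ^+ 2).
  rewrite sqrtrM ?ler0n // sqrtr_sqr ger0_norm ?divr_ge0 ?ler0n //.
  rewrite -{3}(sqr_sqrtr (ltW sR)); field; rewrite gt_eqF //.
rewrite /l2norm ler_wsqrtr //.
apply: (@le_trans _ _ (\sum_(i in J1) (a / s%:R) ^+ 2)); last first.
  by rewrite sumr_const -[leLHS]mulr_natl ler_wpM2r ?sqr_ge0 // ler_nat.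
rewrite [leRHS]big_mkcond; apply: ler_sum => i _; rewrite mxE.
case: ifP => _; last by rewrite expr0n.
rewrite -real_normK ?num_real // ler_pXn2r ?nnegrE //.
by rewrite divr_ge0 // ltW.
Qed.

End sparsity.

(** * Instance optimality and the decoder *)

Section recovery.
Variable R : realType.

Section sigma.
Variables (k n l : nat) (G : 'cV[R]_k -> 'cV[R]_n).

Lemma has_inf_sigma x : has_inf [set l1norm (x - xh) | xh in S_sG l G].
Proof.
split; last by exists 0 => _ [xh _ <-]; exact: l1norm_ge0.
exists (l1norm (x - G 0)); exists (G 0) => //; exists 0 => /=.
by rewrite /S_s /= subrr l0normE (eq_card0 (A := _)) // => i; rewrite !inE mxE eqxx.
Qed.

Lemma sigma_approx x e : 0 < e ->
  exists2 xh, S_sG l G xh & l1norm (x - xh) < sigma_lG l G x + e.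
Proof.
move=> e0; have [_ [xh Sxh <-] h] := inf_adherent e0 (has_inf_sigma x).
by exists xh.
Qed.

Lemma sigma_lipschitz x y : sigma_lG l G x <= sigma_lG l G y + l1norm (x - y).
Proof.
apply/ler_addgt0Pr => e e0; have [xh Sxh h] := sigma_approx y e0.
apply: (@le_trans _ _ (l1norm (x - xh))).
  by apply: ge_inf; [case: (has_inf_sigma x)|exists xh].
rewrite -(subrK y x) -addrA.
apply: le_trans (l1normD _ _) _; rewrite addrK; lra.
Qed.

Variables (m : nat) (A : 'M[R]_(m, n)) (alpha : R).
Hypothesis alpha01 : 0 < alpha < 1.
Hypothesis l_gt0 : (0 < l)%N.
Hypothesis A_near_isometry : forall z z' v, (l0norm v <= 4 * l)%N ->
  let u := G z - G z' + v in
  `|dot (A *m u) (A *m u) - dot u u| <= alpha * dot u u.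

(** The hypothesis bounds squared norms; [(1 - alpha)^2 <= 1 - alpha] yields the constant of the
    theorem without square roots. *)
Lemma near_isometry_ge z z' v : (l0norm v <= 4 * l)%N ->
  let u := G z - G z' + v in (1 - alpha) * l2norm u <= l2norm (A *m u).
Proof.
case/andP: alpha01 => al0 al1 /(A_near_isometry z z') /=.
set u := G z - G z' + v; rewrite ler_norml => /andP[h _].
rewrite -(@ler_pXn2r _ 2) ?nnegrE ?mulr_ge0 ?l2norm_ge0 ?subr_ge0 ?(ltW al1) //.
rewrite exprMn !sqr_l2norm; apply: (@le_trans _ _ ((1 - alpha) * dot u u)).
  by rewrite ler_wpM2r ?dot_ge0 //; nra.
by lra.
Qed.

(** Taking [z = z'] cancels the network, so sparse vectors are themselves of the tested form; then
    [1 + alpha <= (1 + alpha)^2]. *)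
Lemma near_isometry_le v : (l0norm v <= 4 * l)%N ->
  l2norm (A *m v) <= (1 + alpha) * l2norm v.
Proof.
case/andP: alpha01 => al0 al1 /(A_near_isometry 0 0) /=.
rewrite subrr add0r ler_norml => /andP[_ h].
rewrite -(@ler_pXn2r _ 2) ?nnegrE ?mulr_ge0 ?l2norm_ge0 ?addr_ge0 ?(ltW al0) //.
rewrite exprMn !sqr_l2norm; apply: (@le_trans _ _ ((1 + alpha) * dot v v)).
  by lra.
by rewrite ler_wpM2r ?dot_ge0 //; nra.
Qed.

Lemma instance_optimality x1 x2 :
  l2norm (x1 - x2) <=
    (Num.sqrt (2 * l%:R))^-1 * ((1 + alpha) / (1 - alpha) + 1) *
      (sigma_lG l G x1 + sigma_lG l G x2)
    + (1 - alpha)^-1 * l2norm (A *m (x1 - x2)).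
Proof.
have [al0 al1] := andP alpha01.
set K := _ * (_ + 1).
have q0 : 0 < Num.sqrt (2 * l%:R) :> R by rewrite sqrtr_gt0 mulr_gt0 // ltr0n.
have b0 : 0 < 1 - alpha by rewrite subr_gt0.
have K0 : 0 < K.
  by rewrite mulr_gt0 ?invr_gt0 // addr_gt0 // divr_gt0 // addr_gt0.
apply/ler_addgt0Pr => e e0.
(* [sigma_lG] is an infimum that need not be attained; two approximants with error [eta] cost
   [K * (2 * eta) = e] in total. *)
pose eta := e / (2 * K).
have eta0 : 0 < eta by rewrite divr_gt0 // mulr_gt0.
have [xh1 [z1 Sx1] h1] := sigma_approx x1 eta0.
have [xh2 [z2 Sx2] h2] := sigma_approx x2 eta0.
pose v := (x1 - xh1) - (x2 - xh2).
have l20 : (0 < 2 * l)%N by rewrite muln_gt0.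
have [J [ws [Js wss vE wsle]]] := block_decomposition v l20.
(* Origin of the sparsity [4 l]: each approximant differs from the range of [G] in at most [l]
   entries, and the head block has at most [2 l]. *)
pose sp := (xh1 - G z1) - (xh2 - G z2) + restrict J v.
have sp4 : (l0norm sp <= 4 * l)%N.
  rewrite (leq_trans (l0normD _ _)) // (_ : 4 * l = (l + l) + 2 * l)%N; last by lia.
  rewrite leq_add // ?(leq_trans (l0norm_restrict _ _)) //.
  by rewrite (leq_trans (l0normD _ _)) // leq_add // l0normN.
pose u := G z1 - G z2 + sp; pose tl := \sum_(w <- ws) w.
have xE : x1 - x2 = u + tl.
  have -> : x1 - x2 = xh1 - xh2 + v by rewrite /v; apply/colP => i; rewrite !mxE; ring.
  by rewrite [in LHS]vE /u /sp; apply/colP => i; rewrite !mxE; ring.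
have tlle : \sum_(w <- ws) l2norm w <= (Num.sqrt (2 * l%:R))^-1 *
    (sigma_lG l G x1 + sigma_lG l G x2 + 2 * eta).
  apply: le_trans wsle _; rewrite natrM ler_wpM2l ?invr_ge0 ?(ltW q0) //.
  by apply: le_trans (l1normD _ _) _; rewrite l1normN; lra.
have ule : l2norm u <= (1 - alpha)^-1 * (l2norm (A *m (x1 - x2)) +
    (1 + alpha) * \sum_(w <- ws) l2norm w).
  rewrite ler_pdivlMl // (le_trans (near_isometry_ge _ _ sp4)) // -/u.
  have -> : A *m u = A *m (x1 - x2) - A *m tl by rewrite -mulmxBr xE addrK.
  rewrite (le_trans (l2normD _ _)) // lerD2l l2normN /tl mulmx_sumr.
  rewrite -(big_map (mulmx A) predT id) (le_trans (l2norm_sum _)) // big_map mulr_sumr.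
  rewrite big_seq [leRHS]big_seq; apply: ler_sum => w /wss ww.
  by apply: near_isometry_le; rewrite (leq_trans ww) // leq_mul2r orbT.
apply: (@le_trans _ _ (l2norm u + \sum_(w <- ws) l2norm w)).
  by rewrite {1}xE (le_trans (l2normD _ _)) // lerD2l l2norm_sum.
apply: (@le_trans _ _ (((1 + alpha) / (1 - alpha) + 1) * (\sum_(w <- ws) l2norm w)
   + (1 - alpha)^-1 * l2norm (A *m (x1 - x2)))).
  by apply: le_trans (lerD ule (lexx _)) _; lra.
rewrite addrAC lerD2r.
have -> : e = K * (2 * eta) by rewrite /eta; field; rewrite gt_eqF.
rewrite -mulrDr /K -mulrA mulrCA; apply: ler_wpM2l => //.
rewrite addr_ge0 // divr_ge0 ?(ltW b0) //; lra.
Qed.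

End sigma.

(** Phrased on row vectors, the form in which [bounded_closed_compact] is applied in
    [decoder_exists]. *)
Lemma l1_lipschitz_continuous n (f : 'cV[R]_n -> R) (L : R) :
  (forall x y, f x <= f y + L * l1norm (x - y)) ->
  continuous (fun v : 'rV[R]_n => f v^T).
Proof.
move=> fL v; apply/(@cvgrPdist_lt _ _ _ (nbhs v) (nbhs_filter v)) => e e0.
pose d := e / ((`|L| + 1) * n.+1%:R).
have d0 : 0 < d by rewrite divr_gt0 // mulr_gt0 ?ltr0n // ltr_wpDl.
near=> w.
have wv : `|v - w| < d by near: w; exact: cvgr_dist_lt.
have l1le : l1norm (v^T - w^T) <= n%:R * d.
  rewrite mulr_natl -[X in _ *+ X]card_ord -sumr_const; apply: ler_sum => i _.
  rewrite !mxE; apply: le_trans (ltW wv).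
  have -> : v 0 i - w 0 i = (v - w) 0 i by rewrite !mxE.
  rewrite [leRHS]/Num.norm /= mx_normrE; apply/bigmax_geP; right => /=.
  by exists (0, i).
have nd : (`|L| + 1) * (n%:R * d) < e.
  have L1 : 0 < `|L| + 1 by rewrite ltr_wpDl.
  have -> : e = (`|L| + 1) * (n.+1%:R * d).
    by rewrite /d; field; rewrite !gt_eqF ?ltr0n.
  by rewrite ltr_pM2l // ltr_pM2r // ltr_nat.
have Lle : L * l1norm (v^T - w^T) <= (`|L| + 1) * (n%:R * d).
  apply: le_trans (ler_norm _) _; rewrite normrM (ger0_norm (l1norm_ge0 _)).
  by apply: ler_pM => //; [exact: l1norm_ge0|rewrite lerDl].
have h1 := fL v^T w^T; have h2 := fL w^T v^T.
rewrite -l1normN opprB in h2.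
rewrite ltr_norml; apply/andP; split; lra.
Unshelve. all: by end_near. Qed.

Lemma l2norm_le_l1norm n (x : 'cV[R]_n) : l2norm x <= l1norm x.
Proof.
rewrite -(@ler_pXn2r _ 2) ?nnegrE ?l2norm_ge0 ?l1norm_ge0 // sqr_l2norm dotE.
rewrite expr2 {1}/l1norm mulr_suml; apply: ler_sum => i _.
apply: le_trans (ler_norm _) _; rewrite normrM ler_wpM2l //.
by rewrite /l1norm (bigD1 i) //= lerDl sumr_ge0.
Qed.

Lemma l1norm_mulmx_le m n (A : 'M[R]_(m, n)) (x : 'cV[R]_n) :
  l1norm (A *m x) <= (\sum_i \sum_j `|A i j|) * l1norm x.
Proof.
rewrite mulr_suml; apply: ler_sum => i _; rewrite mxE.
apply: le_trans (ler_norm_sum _ _ _) _; rewrite mulr_suml; apply: ler_sum => j _.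
by rewrite normrM ler_wpM2l // /l1norm (bigD1 j) //= lerDl sumr_ge0.
Qed.

(* The decoder minimizes [sg] over all signals consistent with the measurements;
   the instance optimality bound itself makes the sublevel sets bounded. *)
Lemma decoder_exists m n (A : 'M[R]_(m, n)) (sg : 'cV[R]_n -> R) (a b em : R) :
  0 <= a -> 0 <= b ->
  (forall x y, sg x <= sg y + l1norm (x - y)) ->
  (forall x1 x2, l2norm (x1 - x2) <= a * (sg x1 + sg x2) + b * l2norm (A *m (x1 - x2))) ->
  exists Delta : 'cV[R]_m -> 'cV[R]_n, forall x eps, l2norm eps <= em ->
    l2norm (x - Delta (A *m x + eps)) <= 2 * a * sg x + 2 * b * em.
Proof.
move=> a0 b0 sgL inst.
pose res y x := l2norm (A *m x - y).
have resC y x : res y x = l2norm (y - A *m x) by rewrite /res -l2normN opprB.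
have two y x1 x2 : res y x1 <= em -> res y x2 <= em ->
    l2norm (A *m (x1 - x2)) <= 2 * em.
  rewrite (resC _ x2) => h1 h2.
  have -> : A *m (x1 - x2) = (A *m x1 - y) + (y - A *m x2).
    by rewrite mulmxBr addrA subrK.
  by apply: le_trans (l2normD _ _) _; move: h1; rewrite /res; lra.
suff /choice[Delta HD] : forall y, exists x', forall x, res y x <= em ->
    res y x' <= em /\ sg x' <= sg x.
  exists Delta => x eps he.
  have hx : res (A *m x + eps) x <= em by rewrite resC addrAC subrr add0r.
  have [h1 h2] := HD _ _ hx.
  apply: le_trans (inst _ _) _.
  have := two _ _ _ hx h1; nra.
(* Measurements consistent with no signal may be decoded arbitrarily, here as [0]. *)
move=> y; have [[x0 hx0]|no] := pselect (exists x0, res y x0 <= em); last first.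
  by exists 0 => x hx; case: no; exists x.
pose F := [set v : 'rV[R]_n | res y v^T <= em /\ sg v^T <= sg x0].
have cres : continuous (fun v : 'rV[R]_n => res y v^T).
  apply: (@l1_lipschitz_continuous _ _ (\sum_i \sum_j `|A i j|)) => x x'.
  rewrite /res; have -> : A *m x - y = (A *m x' - y) + A *m (x - x').
    by rewrite mulmxBr [RHS]addrC addrA subrK.
  apply: le_trans (l2normD _ _) _; rewrite lerD2l.
  exact: le_trans (l2norm_le_l1norm _) (l1norm_mulmx_le _ _).
have csg : continuous (fun v : 'rV[R]_n => sg v^T).
  by apply: (@l1_lipschitz_continuous _ _ 1) => x x'; rewrite mul1r.
have Fcl : closed F.
  apply: closedI.
    apply: (@closed_comp _ _ (fun v : 'rV[R]_n => res y v^T) [set r | r <= em]).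
      by move=> v _; exact: cres.
    exact: closed_le.
  apply: (@closed_comp _ _ (fun v : 'rV[R]_n => sg v^T) [set r | r <= sg x0]).
    by move=> v _; exact: csg.
  exact: closed_le.
(* Any [v] in [F] is compared with [x0]: both have [sg] at most [sg x0] and residual at most [em],
   so [inst] bounds their distance. *)
have Fbd : bounded_set F.
  exists (l2norm x0 + (a * (sg x0 + sg x0) + b * (2 * em))); split; first exact: num_real.
  move=> M hM v [hv1 hv2].
  rewrite /= [leLHS]/Num.norm /= mx_normrE; apply/bigmax_leP; split.
    apply: le_trans (ltW hM); rewrite addr_ge0 ?l2norm_ge0 //.
    by apply: le_trans (l2norm_ge0 (x0 - x0)) (le_trans (inst _ _) _);
      rewrite lerD2l ler_wpM2l // (two y).
  move=> [i j] _ /=; apply: le_trans (ltW hM); rewrite ord1.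
  apply: (@le_trans _ _ (l2norm v^T)).
    rewrite -sqrtr_sqr /l2norm ler_wsqrtr // (bigD1 j) //= mxE lerDl.
    by rewrite sumr_ge0 // => i' _; rewrite sqr_ge0.
  rewrite -{1}(subrK x0 v^T) addrC; apply: le_trans (l2normD _ _) _.
  rewrite lerD2l (le_trans (inst _ _)) // lerD // ler_wpM2l //.
    by rewrite lerD2r.
  exact: two hv1 hx0.
have F0 : F !=set0 by exists x0^T; rewrite /F /= trmxK.
have [c cF cmin] := compact_EVT_min F0 (bounded_closed_compact Fbd Fcl)
  (continuous_subspaceT csg).
move: cF; rewrite inE => -[cF1 cF2].
exists c^T => x hx; split => //.
have [hx0x|/ltW hx0x] := leP (sg x) (sg x0); last exact: le_trans hx0x.
by have := cmin x^T; rewrite inE trmxK; apply; rewrite /F /= trmxK.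
Qed.

End recovery.

(** * Gaussian concentration *)

Section layer_cake.
Context d (T : measurableType d) (R : realType).
Variable mu : {sigma_finite_measure set T -> \bar R}.

Let slice (g f : T -> R) (p : T * measurableTypeR R) : \bar R :=
  (g p.1 * (0 <= p.2 < f p.1)%R%:R)%:E.

Let sliceE (g f : T -> R) (t : measurableTypeR R) :
  (\int[mu]_w (g w * \1_[set x | (0 <= t < f x)%R] w)%:E =
   \int[mu]_w slice g f (w, t))%E.
Proof. by apply: eq_integral => w _; rewrite indicE mem_setE. Qed.

Let measurable_slice (g f : T -> R) :
  measurable_fun setT g -> measurable_fun setT f ->
  measurable_fun [set: T * g_sigma_algebraType (R.-ocitv).-measurable] (slice g f).
Proof.
move=> mg mf.
apply/measurable_EFinP; apply: measurable_funM; first exact: measurableT_comp.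
have mb : measurable_fun setT
    (fun p : T * measurableTypeR R => (0 <= p.2) && (p.2 < f p.1)).
  apply: measurable_and; first exact: measurable_fun_ler.
  by apply: measurable_fun_ltr => //; exact: measurableT_comp.
exact: (measurableT_comp (f := fun b : bool => b%:R : R)) mb.
Qed.

Lemma measurable_layer_cake (g f : T -> R) :
  measurable_fun setT g -> measurable_fun setT f -> (forall w, 0 <= g w) ->
  measurable_fun [set: measurableTypeR R]
    (fun t => \int[mu]_w (g w * \1_[set x | (0 <= t < f x)%R] w)%:E)%E.
Proof.
move=> mg mf g0; under eq_fun do rewrite sliceE.
apply: (@measurable_fun_fubini_tonelli_G _ _ T (measurableTypeR R) R mu (slice g f)).
  exact: measurable_slice.
by move=> p; rewrite lee_fin mulr_ge0.
Qed.

(** Tonelli applied to [f w], written as the length of [[0, f w)]. The weight [g] stands for the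
    remaining factors in [integral_prod_independent] and for the density in [integral_density]. *)
Lemma layer_cake (g f : T -> R) :
  measurable_fun setT g -> measurable_fun setT f ->
  (forall w, 0 <= g w) -> (forall w, 0 <= f w) ->
  (\int[mu]_w (g w * f w)%:E =
   \int[lebesgue_measure]_t \int[mu]_w (g w * \1_[set x | (0 <= t < f x)%R] w)%:E)%E.
Proof.
move=> mg mf g0 f0; under [RHS]eq_integral do rewrite sliceE.
have k0 p : (0 <= slice g f p)%E by rewrite lee_fin mulr_ge0.
rewrite -(@fubini_tonelli _ _ T (measurableTypeR R) R mu lebesgue_measure
  _ (measurable_slice mg mf) k0).
apply: eq_integral => w _; rewrite /slice /=.
under eq_integral => t _.
  rewrite (_ : (0 <= t < f w) = (t \in `[0, f w[%classic)); last by rewrite mem_setE in_itv.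
  rewrite -indicE EFinM; over.
rewrite ge0_integralZl //=; last 2 first.
- by apply/measurable_EFinP; exact: measurable_indic.
- by rewrite lee_fin.
rewrite integral_indic // setIT EFinM; congr (_ * _)%E.
have -> // : (f w)%:E = lebesgue_measure (`[0, f w[%classic : set R).
rewrite lebesgue_measure_itv /= lte_fin.
case: ltP => [_|f_le0]; first by rewrite oppr0 adde0.
by have -> : f w = 0 by apply/eqP; rewrite eq_le f_le0 f0.
Qed.

End layer_cake.

(** * Independence, densities, and linear forms of the rows *)

Section independence.
Context d (T : measurableType d) (R : realType) (P : probability T R).

Lemma integral_prod_independent (I : finType) (Y : I -> T -> R) (F : I -> R -> R) :
  (forall i, measurable_fun setT (Y i)) -> mutually_independent P Y ->
  (forall i, measurable_fun setT (F i)) -> (forall i x, 0 <= F i x) ->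
  (\int[P]_w (\prod_i F i (Y i w))%:E = \prod_i \int[P]_w (F i (Y i w))%:E)%E.
Proof.
move=> mY indY.
(* Outside [r] the factors are indicators, for which the claim is the definition of independence.
   The induction frees one factor at a time, by writing it as a superposition of indicators. *)
suff H (r : seq I) : forall F : I -> R -> R,
    (forall i, measurable_fun setT (F i)) -> (forall i x, 0 <= F i x) ->
    (forall i, i \notin r -> exists2 B, measurable B & F i = \1_B) ->
    (\int[P]_w (\prod_i F i (Y i w))%:E = \prod_i \int[P]_w (F i (Y i w))%:E)%E.
  by move=> mF F0; apply: (H (enum I)) => // i; rewrite mem_enum.
elim: r => {F} [|j r IH] F mF F0 Fr.
  have /choice[B HB] i : exists B, measurable B /\ F i = \1_B.
    by have [//|B mB FB] := Fr i; exists B.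
  have FE i w : F i (Y i w) = \1_(Y i @^-1` B i) w.
    by rewrite (HB i).2 !indicE.
  have mYB i : measurable (Y i @^-1` B i).
    by rewrite -[X in measurable X]setTI; apply: mY => //; exact: (HB i).1.
  transitivity (P (\bigcap_i (Y i @^-1` B i))).
    rewrite -[in RHS](setIT (\bigcap_i _)) -integral_indic //; last first.
      by apply: fin_bigcap_measurable => //; exact: finite_finset.
    apply: eq_integral => w _; congr (_%:E); under eq_bigr do rewrite FE indicE.
    rewrite indicE; case: (boolP (w \in \bigcap_i _)) => [|/negP].
      rewrite inE => h; rewrite big1 // => i _; rewrite mem_set //; exact: h.
    rewrite inE => h.
    have [i hi] : exists i, ~ (Y i @^-1` B i) w.
      by apply: contrapT => nh; apply: h => i _; apply: contrapT => ni; apply: nh; exists i.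
    by rewrite (bigD1 i) //= memNset // mul0r.
  rewrite indY; last by move=> i; exact: (HB i).1.
  apply: eq_bigr => i _; under eq_integral do rewrite FE.
  by rewrite integral_indic // setIT.
pose g w := \prod_(i | i != j) F i (Y i w).
have mg : measurable_fun setT g.
  rewrite /g; under eq_fun do rewrite -big_filter.
  apply: measurable_prod => i _; apply: measurableT_comp => //.
have g0 w : 0 <= g w by apply: prodr_ge0.
have mFj : measurable_fun setT (fun w => F j (Y j w)) by exact: measurableT_comp.
pose K := (\prod_(i | i != j) \int[P]_w (F i (Y i w))%:E)%E.
have K0 : (0 <= K)%E.
  by apply: prode_ge0 => i _; apply: integral_ge0 => w _; rewrite lee_fin.
have gB (B : set R) : measurable B ->
    (\int[P]_w (g w * \1_B (Y j w))%:E = K * \int[P]_w (1 * \1_B (Y j w))%:E)%E.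
  move=> mB; pose F' i := if i == j then \1_B else F i.
  have F'j w : F' j (Y j w) = \1_B (Y j w) by rewrite /F' eqxx.
  have F'N i : i != j -> F' i = F i by rewrite /F' => /negbTE ->.
  transitivity (\int[P]_w (\prod_i F' i (Y i w))%:E)%E.
    apply: eq_integral => w _; rewrite [in RHS](bigD1 j) //= F'j mulrC.
    by congr ((_ * _)%:E); apply: eq_bigr => i ij; rewrite F'N.
  rewrite IH.
  - rewrite (bigD1 j) //= muleC; congr (_ * _)%E.
      by apply: eq_bigr => i ij; rewrite F'N.
    by apply: eq_integral => w _; rewrite mul1r F'j.
  - by move=> i; rewrite /F'; case: eqP => // _; exact: measurable_indic.
  - by move=> i x; rewrite /F'; case: eqP => // _; rewrite indicE.
  - move=> i ir; have [->|ij] := eqVneq i j; first by exists B; rewrite // /F' eqxx.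
    by rewrite F'N //; apply: Fr; rewrite inE negb_or ij.
under eq_integral do rewrite (bigD1 j) //= mulrC -/(g _).
rewrite (layer_cake P mg mFj) // [RHS](bigD1 j) //= -/K.
have B_meas t : measurable [set y : R | 0 <= t < F j y].
  have -> : [set y : R | 0 <= t < F j y] =
      setT `&` (fun y => (0 <= t) && (t < F j y)) @^-1` [set true].
    by rewrite setTI; apply/seteqP; split => y /=.
  by apply: measurable_and => //; exact: measurable_fun_ltr.
have BE t w : \1_[set x | 0 <= t < F j (Y j x)] w = \1_[set y : R | 0 <= t < F j y] (Y j w) :> R.
  by rewrite !indicE !mem_setE.
under eq_integral => t _.
  under eq_integral do rewrite BE.
  rewrite gB //; over.
have -> : (\int[P]_w (F j (Y j w))%:E = \int[P]_w (1 * F j (Y j w))%:E)%E.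
  by apply: eq_integral => w _; rewrite mul1r.
rewrite (layer_cake P (measurable_cst _) mFj) // muleC -ge0_integralZl //.
- exact: measurable_layer_cake.
- by move=> t _; apply: integral_ge0 => w _; rewrite lee_fin mulr_ge0.
Qed.

Lemma integral_density (X : T -> R) (phi f : R -> R) :
  measurable_fun setT X -> measurable_fun setT phi -> measurable_fun setT f ->
  (forall x, 0 <= phi x) -> (forall x, 0 <= f x) ->
  (forall B, measurable B ->
    P (X @^-1` B) = \int[lebesgue_measure]_(x in B) (phi x)%:E)%E ->
  (\int[P]_w (f (X w))%:E = \int[lebesgue_measure]_x (phi x * f x)%:E)%E.
Proof.
move=> mX mphi mf phi0 f0 Xphi.
have mfX : measurable_fun setT (fun w => f (X w)) by exact: measurableT_comp.
transitivity (\int[P]_w (1 * f (X w))%:E)%E.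
  by apply: eq_integral => w _; rewrite mul1r.
rewrite (layer_cake P (measurable_cst _) mfX) //.
rewrite (@layer_cake _ (measurableTypeR R) R lebesgue_measure phi f) //.
apply: eq_integral => t _.
have mB : measurable [set y : R | 0 <= t < f y].
  have -> : [set y : R | 0 <= t < f y] =
      setT `&` (fun y => (0 <= t) && (t < f y)) @^-1` [set true].
    by rewrite setTI; apply/seteqP; split => y /=.
  by apply: measurable_and => //; exact: measurable_fun_ltr.
transitivity (P (X @^-1` [set y : R | 0 <= t < f y])).
  rewrite -[in RHS](setIT (X @^-1` _)) -integral_indic //; last first.
    by rewrite -[X in measurable X]setTI; exact: mX.
  by apply: eq_integral => w _; rewrite mul1r !indicE !mem_setE.
rewrite Xphi // integral_mkcond; apply: eq_integral => x _.
by rewrite patchE indicE; case: ifP => _; rewrite ?mulr1 ?mulr0.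
Qed.

Lemma independent_row m n (X : 'I_m -> 'I_n -> T -> R) i :
  mutually_independent P (fun p : 'I_m * 'I_n => X p.1 p.2) ->
  mutually_independent P (X i).
Proof.
move=> indX B mB; pose B' (p : 'I_m * 'I_n) := if p.1 == i then B p.2 else setT.
have mB' p : measurable (B' p) by rewrite /B'; case: eqP.
have := indX B' mB'.
rewrite -(pair_bigA _ (fun i' j => P (X i' j @^-1` B' (i', j)))) /=.
rewrite (bigD1 i) //= [X in (_ * X)%E]big1 ?mule1; last first.
  move=> i' /negbTE ii'; apply: big1 => j _.
  by rewrite /B' /= ii' preimage_setT probability_setT.
under eq_bigr do rewrite /B' /= eqxx.
move=> <-; congr (P _); apply/seteqP; split => w h.
  by move=> [i' j] _; rewrite /B' /=; case: eqP => // ->; exact: h.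
by move=> j _; have := h (i, j) Logic.I; rewrite /B' /= eqxx.
Qed.

(* Rectangles of a row form a pi-system, so the product rule extends one row at a
   time from rectangles to the sigma-algebra generated by that row. *)
Lemma independent_rows m n (X : 'I_m -> 'I_n -> T -> R) (u : 'I_n -> R) :
  (forall i j, measurable_fun setT (X i j)) ->
  mutually_independent P (fun p : 'I_m * 'I_n => X p.1 p.2) ->
  mutually_independent P (fun (i : 'I_m) w => \sum_j u j * X i j w).
Proof.
move=> mX indX.
pose rect i : set (set T) := [set C | exists2 B : 'I_n -> set R,
  (forall j, measurable (B j)) & C = \bigcap_j (X i j @^-1` B j)].
have mXB i j (B : set R) : measurable B -> measurable (X i j @^-1` B).
  by move=> mB; rewrite -[X in measurable X]setTI; exact: mX.
have rect_measurable i : rect i `<=` measurable.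
  move=> _ [B mB ->]; apply: fin_bigcap_measurable => [|j _]; first exact: finite_finset.
  exact: mXB.
have sub_measurable i : <<s rect i >> `<=` measurable.
  by apply: smallest_sub => //; exact: sigma_algebra_measurable.
have rectT i : rect i setT.
  exists (fun=> setT) => //; apply/seteqP; split => // w _ j _ //.
have rectI i : setI_closed (rect i).
  move=> _ _ [B mB ->] [C mC ->]; exists (fun j => B j `&` C j).
    by move=> j; exact: measurableI.
  by rewrite bigcapI.
have H (r : seq 'I_m) : forall C : 'I_m -> set T,
    (forall i, i \in r -> <<s rect i >> (C i)) ->
    (forall i, i \notin r -> rect i (C i)) ->
    P (\bigcap_i C i) = (\prod_i P (C i))%E.
  elim: r => [|j r IH] C sC rC.
    have /choice[B HB] i : exists B : 'I_n -> set R,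
        (forall j, measurable (B j)) /\ C i = \bigcap_j (X i j @^-1` B j).
      by have [//|B mB CB] := rC i; exists B.
    have PE (i : 'I_m) : P (C i) = (\prod_j P (X i j @^-1` B i j))%E.
      by rewrite (HB i).2 (independent_row i indX) //; exact: (HB i).1.
    under [RHS]eq_bigr do rewrite PE.
    rewrite pair_bigA /= -(indX (fun p => B p.1 p.2)); last by move=> p; exact: (HB _).1.
    congr (P _); apply/seteqP; split => w h.
      by move=> [i j] _ /=; have := h i Logic.I; rewrite (HB i).2; exact.
    by move=> i _; rewrite (HB i).2 => j _; exact: (h (i, j)).
  pose D := \bigcap_(i in [set i | i != j]) C i.
  have CE : \bigcap_i C i = C j `&` D.
    apply/seteqP; split => [w h|w [h1 h2] i _]; first by split => [|i _]; exact: h.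
    by have [->//|ij] := eqVneq i j; exact: h2.
  have mC i : measurable (C i).
    have [/sC /sub_measurable //|/rC /rect_measurable //] := boolP (i \in j :: r).
  have mD : measurable D.
    by apply: fin_bigcap_measurable => //; exact: finite_finset.
  have [jr|jr] := boolP (j \in r).
    apply: IH => i ir; first by apply: sC; rewrite inE ir orbT.
    by apply: rC; rewrite inE negb_or ir andbT; apply: contraNneq ir => ->.
  pose K := (\prod_(i | i != j) P (C i))%E.
  have rectD E : rect j E -> P (E `&` D) = (P E * K)%E.
    move=> rE; pose C' i := if i == j then E else C i.
    have C'N i : i != j -> C' i = C i by rewrite /C' => /negbTE ->.
    have -> : E `&` D = \bigcap_i C' i.
      apply/seteqP; split => [w [hE hD] i _|w h].
        by rewrite /C'; case: eqP => // /eqP ij; exact: hD.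
      split => [|i ij]; first by have := h j Logic.I; rewrite /C' eqxx.
      by have := h i Logic.I; rewrite C'N.
    rewrite IH.
    - rewrite (bigD1 j) //= {1}/C' eqxx; congr (_ * _)%E.
      by apply: eq_bigr => i ij; rewrite C'N.
    - move=> i ir; have ij : i != j by apply: contraNneq jr => <-.
      by rewrite C'N //; apply: sC; rewrite inE ir orbT.
    - move=> i ir; have [->|ij] := eqVneq i j; first by rewrite /C' eqxx.
      by rewrite C'N //; apply: rC; rewrite inE negb_or ij.
  have KE : K = P D by rewrite -[D]setTI rectD // probability_setT mul1e.
  have kE : ((fine (P D))%:E = P D)%E by rewrite fineK // fin_num_measure.
  have k0 : 0 <= fine (P D) by rewrite fine_ge0.
  rewrite CE [RHS](bigD1 j) //= -/K KE muleC -kE.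
  (* The measures [E |-> P (E & D)] and [E |-> P D * P E] agree on rectangles of row [j], hence on
     the sigma-algebra they generate. *)
  have := @g_sigma_algebra_measure_unique _ R T (rect j) (@rect_measurable j)
    (fun=> setT) (fun=> rectT j) _ (mrestr P mD) (mscale (NngNum k0) P) (@rectI j).
  apply.
  - by rewrite bigcup_const //; exists 0%N.
  - by move=> E rE; rewrite [LHS](rectD E rE) KE muleC -{1}kE.
  - move=> _; apply: (@le_lt_trans _ _ 1%E); last exact: ltry.
    exact: (probability_le1 P (measurableI _ _ measurableT mD)).
  - by apply: sC; rewrite mem_head.
move=> B mB; apply: (H (enum 'I_m)) => [i _|i]; last by rewrite mem_enum.
have mZ : measurable_fun [set: g_sigma_algebraType (rect i)]
    (fun w => \sum_j u j * X i j w).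
  apply: measurable_sum => j; apply: measurable_funM; first exact: measurable_cst.
  move=> _ A mA; rewrite setTI; apply: sub_sigma_algebra.
  exists (fun j' => if j' == j then A else setT); first by move=> j'; case: ifP.
  apply/seteqP; split => [w h j' _|w /(_ j Logic.I)]; last by rewrite eqxx.
  by case: eqP => // ->.
by have := mZ measurableT (B i) (mB i); rewrite setTI.
Qed.

End independence.

(** * Exponential moments and tails of Gaussian quadratic forms *)

Section gaussian.
Variable R : realType.
Local Notation leb := (@lebesgue_measure R).

(** Completing the square: an exponential tilt shifts the mean by [lambda * s^2]. *)
Lemma expR_normal_pdf (s lambda x : R) : s != 0 ->
  normal_pdf 0 s x * expR (lambda * x) =
  expR (lambda ^+ 2 * s ^+ 2 / 2) * normal_pdf (lambda * s ^+ 2) s x.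
Proof.
move=> s0; rewrite !normal_pdfE //= mulrCA mulrAC -mulrA; congr (_ * _).
rewrite /normal_fun -!expRD; congr expR; field.
by rewrite s0.
Qed.

(** A quadratic tilt keeps the density Gaussian and changes its variance from 1 to
    [1 / (1 - 2 s)]. *)
Lemma expR_sqr_normal_pdf (s x : R) : s < 1 / 2 ->
  normal_pdf 0 1 x * expR (s * x ^+ 2) =
  (Num.sqrt (1 - 2 * s))^-1 * normal_pdf 0 (Num.sqrt (1 - 2 * s))^-1 x.
Proof.
move=> s2; have q0 : 0 < 1 - 2 * s by lra.
have r0 : 0 < Num.sqrt (1 - 2 * s) by rewrite sqrtr_gt0.
rewrite !normal_pdfE ?oner_neq0 ?invr_eq0 ?gt_eqF //= [RHS]mulrA -[LHS]mulrA; congr (_ * _).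
  rewrite /normal_peak expr1n mul1r exprVn sqr_sqrtr ?ltW //.
  rewrite -mulrnAr sqrtrM ?invr_ge0 ?ltW // sqrtrV ?ltW // invfM invrK.
  by rewrite mulrA mulVf ?mul1r // gt_eqF.
rewrite /normal_fun -expRD; congr expR; rewrite exprVn sqr_sqrtr ?ltW //.
by field; rewrite gt_eqF.
Qed.

Lemma integral_expR_normal_pdf (s lambda : R) : s != 0 ->
  (\int[leb]_x (normal_pdf 0 s x * expR (lambda * x))%:E =
   (expR (lambda ^+ 2 * s ^+ 2 / 2))%:E)%E.
Proof.
move=> s0; under eq_integral do rewrite expR_normal_pdf // EFinM.
rewrite ge0_integralZl ?integral_normal_pdf ?mule1 //.
- by apply/measurable_EFinP; exact: measurable_normal_pdf.
- by move=> x _; rewrite lee_fin normal_pdf_ge0.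
Qed.

Lemma integral_expR_sqr_normal_pdf (s : R) : s < 1 / 2 ->
  (\int[leb]_x (normal_pdf 0 1 x * expR (s * x ^+ 2))%:E =
   (Num.sqrt (1 - 2 * s))^-1%:E)%E.
Proof.
move=> s2; under eq_integral do rewrite expR_sqr_normal_pdf // EFinM.
rewrite ge0_integralZl ?integral_normal_pdf ?mule1 //.
- by apply/measurable_EFinP; exact: measurable_normal_pdf.
- by move=> x _; rewrite lee_fin normal_pdf_ge0.
Qed.

Context d (T : measurableType d) (P : probability T R).

(* [expR (s y^2)] is the Gaussian average over [h] of [expR (sqrt (2 s) h y)], which
   factors over the independent summands of [y]. *)
Lemma integral_expR_sqr_gaussian_sum n (X : 'I_n -> T -> R) (u : 'I_n -> R)
    (sigma s : R) :
  (forall j, measurable_fun setT (X j)) -> mutually_independent P X ->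
  0 < sigma ->
  (forall j B, measurable B -> P (X j @^-1` B) = normal_prob 0 sigma B) ->
  \sum_j u j ^+ 2 = 1 -> 0 <= s < 1 / 2 ->
  (\int[P]_w (expR (s / sigma ^+ 2 * (\sum_j u j * X j w) ^+ 2))%:E =
   (Num.sqrt (1 - 2 * s))^-1%:E)%E.
Proof.
move=> mX indX sg0 lawX u1 /andP[s0 s2].
pose Y w := \sum_j u j * X j w.
have mY : measurable_fun setT Y.
  by apply: measurable_sum => j; apply: measurable_funM => //; exact: measurable_cst.
pose c := Num.sqrt (2 * s) / sigma.
have cc : c ^+ 2 = 2 * s / sigma ^+ 2.
  by rewrite exprMn exprVn sqr_sqrtr // mulr_ge0.
clearbody c.
pose k (p : T * measurableTypeR R) : \bar R :=
  (normal_pdf 0 1 p.2 * expR (c * Y p.1 * p.2))%:E.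
have k0 p : (0 <= k p)%E by rewrite lee_fin mulr_ge0 ?normal_pdf_ge0 ?expR_ge0.
have mk : measurable_fun [set: T * g_sigma_algebraType (R.-ocitv).-measurable] k.
  apply/measurable_EFinP; apply: measurable_funM.
    by apply: (measurableT_comp (measurable_normal_pdf 0 1)).
  apply: (measurableT_comp (@measurable_expR R)).
  apply: measurable_funM; last exact: measurable_snd.
  by apply: measurable_funM => //; exact: measurableT_comp.
have := @fubini_tonelli _ _ T (measurableTypeR R) R P lebesgue_measure k mk k0.
rewrite /k /= => fub.
transitivity (\int[P]_w \int[leb]_h (normal_pdf 0 1 h * expR (c * Y w * h))%:E)%E.
  apply: eq_integral => w _; rewrite integral_expR_normal_pdf ?oner_neq0 //.
  by congr (expR _)%:E; rewrite exprMn cc expr1n -/(Y w); field; rewrite gt_eqF.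
rewrite fub -(integral_expR_sqr_normal_pdf s2); apply: eq_integral => h _.
(* For fixed [h] the moment generating functions of the summands multiply, and their variances add
   up through [\sum_j u j ^+ 2 = 1]. *)
have E1 : (\int[P]_w (expR (c * Y w * h))%:E = (expR (s * h ^+ 2))%:E)%E.
  transitivity (\int[P]_w (\prod_j expR (c * h * u j * X j w))%:E)%E.
    apply: eq_integral => w _; rewrite -expR_sum; congr (expR _)%:E.
    by rewrite -mulrA (mulrC (Y w)) mulrA /Y mulr_sumr; apply: eq_bigr => j _; ring.
  rewrite (@integral_prod_independent _ T R P _ X (fun j x => expR (c * h * u j * x))) //.
  - transitivity (\prod_j (expR ((c * h * u j) ^+ 2 * sigma ^+ 2 / 2))%:E)%E.
      apply: eq_bigr => j _.
      rewrite (@integral_density _ T R P (X j) (normal_pdf 0 sigma)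
        (fun x => expR (c * h * u j * x))) //.
      - by rewrite integral_expR_normal_pdf // gt_eqF.
      - exact: measurable_normal_pdf.
      - by apply: (measurableT_comp (@measurable_expR R)); exact: measurable_funM.
      - by move=> x; exact: normal_pdf_ge0.
      - exact: lawX.
    rewrite prodEFin -expR_sum; congr (expR _)%:E.
    rewrite -[RHS]mulr1 -[X in _ = _ * X]u1 mulr_sumr; apply: eq_bigr => j _.
    by rewrite !exprMn cc; field; rewrite gt_eqF.
  - by move=> j; apply: (measurableT_comp (@measurable_expR R)); exact: measurable_funM.
rewrite [RHS]EFinM -E1 -ge0_integralZl //.
- by apply/measurable_EFinP; apply: (measurableT_comp (@measurable_expR R));
    apply: measurable_funM => //; apply: measurable_funM.
- by rewrite lee_fin normal_pdf_ge0.
Qed.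

(** After squaring and [1 + x <= e^x], this is [(1 + 2 s + 8 s^2) (1 - 2 s) = 1 + 4 s^2 (1 - 4 s) >=
    1]. *)
Lemma inv_sqrt_le (s : R) : 0 <= s <= 1 / 4 ->
  (Num.sqrt (1 - 2 * s))^-1 <= expR (s + 4 * s ^+ 2).
Proof.
move=> /andP[s0 s4]; have q0 : 0 < 1 - 2 * s by lra.
have r0 : 0 < Num.sqrt (1 - 2 * s) by rewrite sqrtr_gt0.
rewrite -[leLHS]mul1r ler_pdivrMr //.
rewrite -(@ler_pXn2r _ 2) ?nnegrE ?mulr_ge0 ?expR_ge0 ?(ltW r0) //.
rewrite expr1n exprMn sqr_sqrtr ?(ltW q0) // -expRM_natl.
apply: (@le_trans _ _ ((1 + 2%:R * (s + 4 * s ^+ 2)) * (1 - 2 * s))); last first.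
  by rewrite ler_wpM2r ?(ltW q0) // expR_ge1Dx.
by rewrite -subr_ge0; have := mulr_ge0 (sqr_ge0 s) s0; nra.
Qed.

Lemma inv_sqrt_ge (s : R) : 0 <= s < 1 / 2 ->
  1 + s <= (Num.sqrt (1 - 2 * s))^-1.
Proof.
move=> /andP[s0 s4]; have q0 : 0 < 1 - 2 * s by lra.
have r0 : 0 < Num.sqrt (1 - 2 * s) by rewrite sqrtr_gt0.
rewrite -[leRHS]mul1r ler_pdivlMr //.
rewrite -(@ler_pXn2r _ 2) ?nnegrE ?mulr_ge0 ?(ltW r0) //; last by lra.
rewrite expr1n exprMn sqr_sqrtr ?(ltW q0) //.
by rewrite -subr_ge0; have := mulr_ge0 (sqr_ge0 s) s0; have := sqr_ge0 s; nra.
Qed.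

(** With [t = s v], [e^(-t) + e^t - 2 = (1 - e^(-t))^2 e^t <= t^2 e^t]. Then [v^2 <= 128 e^(v / 8)]
    and [e^t <= e^(v / 8)]. *)
Lemma expR_sqr_tradeoff (s v : R) : 0 <= s <= 1 / 8 -> 0 <= v ->
  expR (- (s * v)) + expR (s * v) <= 2 + 128 * s ^+ 2 * expR (1 / 4 * v).
Proof.
move=> /andP[s0 s8] v0; set t := s * v.
have t0 : 0 <= t by rewrite mulr_ge0.
have h1 : expR (- t) + expR t <= 2 + t ^+ 2 * expR t.
  have h : 0 <= 1 - expR (- t) <= t.
    rewrite subr_ge0 expR_le1 oppr_le0 t0 /=.
    by have := expR_ge1Dx (- t); lra.
  have -> : expR (- t) + expR t = 2 + (1 - expR (- t)) ^+ 2 * expR t.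
    by rewrite -(expRK t) ?expRN; field; rewrite gt_eqF ?expR_gt0.
  rewrite lerD2l ler_wpM2r ?expR_ge0 // ler_pXn2r ?nnegrE //; lra.
apply: (le_trans h1); rewrite lerD2l.
have h2 : v ^+ 2 <= 128 * expR (1 / 8 * v).
  have v8 : 0 <= 1 / 8 * v by rewrite mulr_ge0.
  by have := @expR_ge1Dxn R (1 / 8 * v) 1 v8; rewrite (_ : 2`!%:R = 2 :> R) //; lra.
have h3 : expR t <= expR (1 / 8 * v) by rewrite ler_expR ler_wpM2r.
have -> : 1 / 4 * v = 1 / 8 * v + 1 / 8 * v by field.
rewrite expRD; set E := expR (1 / 8 * v) in h2 h3 *.
have -> : t ^+ 2 * expR t = s ^+ 2 * (v ^+ 2 * expR t).
  by rewrite exprMn mulrA.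
have -> : 128 * s ^+ 2 * (E * E) = s ^+ 2 * (128 * E * E) by ring.
by apply: ler_wpM2l; rewrite ?sqr_ge0 // ler_pM // ?sqr_ge0 ?expR_ge0.
Qed.

(** Averaging over [h] with frequency [sqrt (2 s)] covers only positive exponents. The negative
    moment is deduced from the positive ones at [s] and [1 / 4] by [expR_sqr_tradeoff]; bounding the
    latter, [sqrt 2], by 2 gives [256 = 128 * 2]. *)
Lemma integral_expRN_sqr_gaussian_sum n (X : 'I_n -> T -> R) (u : 'I_n -> R)
    (sigma s : R) :
  (forall j, measurable_fun setT (X j)) -> mutually_independent P X ->
  0 < sigma ->
  (forall j B, measurable B -> P (X j @^-1` B) = normal_prob 0 sigma B) ->
  \sum_j u j ^+ 2 = 1 -> 0 <= s <= 1 / 8 ->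
  (\int[P]_w (expR (- s / sigma ^+ 2 * (\sum_j u j * X j w) ^+ 2))%:E <=
   (expR (- s + 256 * s ^+ 2))%:E)%E.
Proof.
move=> mX indX sg0 lawX u1 s08; have [s0 s8] := andP s08.
pose Y w := \sum_j u j * X j w.
have mY : measurable_fun setT Y.
  by apply: measurable_sum => j; apply: measurable_funM => //; exact: measurable_cst.
pose e (a : R) w := (expR (a / sigma ^+ 2 * Y w ^+ 2))%:E.
have me a : measurable_fun setT (e a).
  apply/measurable_EFinP; apply: (measurableT_comp (@measurable_expR R)).
  by apply: measurable_funM => //; exact: measurable_funX.
have e0 a w : (0 <= e a w)%E by rewrite lee_fin expR_ge0.
have E a : 0 <= a < 1 / 2 -> (\int[P]_w e a w = (Num.sqrt (1 - 2 * a))^-1%:E)%E.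
  by move=> ha; exact: integral_expR_sqr_gaussian_sum.
have s2 : 0 <= s < 1 / 2 by rewrite s0 /=; lra.
have h14 : 0 <= (1 / 4 : R) < 1 / 2 by lra.
have key : (\int[P]_w e (- s)%R w + \int[P]_w e s w <=
    2%:E + (128 * s ^+ 2)%:E * \int[P]_w e (1 / 4)%R w)%E.
  rewrite -ge0_integralD // -ge0_integralZl //; last first.
    by rewrite lee_fin mulr_ge0 ?sqr_ge0.
  have -> : (2%:E = \int[P]_w (cst 2%:E w))%E.
    by rewrite -[LHS]mule1 -(probability_setT P) -integral_cst.
  rewrite -ge0_integralD //; last 2 first.
  - by move=> w _; rewrite mule_ge0 // lee_fin mulr_ge0 ?sqr_ge0.
  - exact: measurable_funeM.
  apply: ge0_le_integral => //.
  - by move=> w _; rewrite adde_ge0.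
  - exact: emeasurable_funD.
  - by apply: emeasurable_funD => //; exact: measurable_funeM.
  move=> w _; rewrite /e -EFinM -!EFinD lee_fin.
  have v0 : 0 <= Y w ^+ 2 / sigma ^+ 2 by rewrite divr_ge0 ?sqr_ge0.
  have := expR_sqr_tradeoff s08 v0.
  rewrite (_ : - (s * _) = - s / sigma ^+ 2 * Y w ^+ 2); last by field; rewrite gt_eqF.
  rewrite (_ : s * (Y w ^+ 2 / _) = s / sigma ^+ 2 * Y w ^+ 2); last by field; rewrite gt_eqF.
  by rewrite (_ : 1 / 4 * (Y w ^+ 2 / _) = 1 / 4 / sigma ^+ 2 * Y w ^+ 2); last by field; rewrite gt_eqF.
  by move=> w _; rewrite lee_fin.
move: key; rewrite (E s) // (E (1 / 4)) // -EFinM -EFinD -leeBrDr // -EFinB => key.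
apply: (le_trans key); rewrite lee_fin; apply: le_trans (expR_ge1Dx _).
have := inv_sqrt_ge s2.
have : (Num.sqrt (1 - 2 * (1 / 4)))^-1 <= 2 :> R.
  rewrite -[leRHS]invrK lef_pV2 ?posrE ?invr_gt0 ?sqrtr_gt0 //; last by lra.
  rewrite -(@ler_pXn2r _ 2) ?nnegrE ?sqrtr_ge0 ?invr_ge0 // sqr_sqrtr; last by lra.
  by rewrite exprVn; lra.
have := sqr_ge0 s; nra.
Qed.

Lemma exponential_markov (V : T -> R) (B a : R) : measurable_fun setT V ->
  (\int[P]_w (expR (V w))%:E <= B%:E)%E ->
  (P [set w | (a <= V w)%R] <= (B * expR (- a))%:E)%E.
Proof.
move=> mV hB.
have mE : measurable_fun setT (fun w => (expR (V w))%:E).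
  by apply/measurable_EFinP; exact: (measurableT_comp (@measurable_expR R)).
have := le_integral_abse P measurableT mE (expR_gt0 a).
rewrite setTI (_ : [set w | _] = [set w | (a <= V w)%R]); last first.
  apply/seteqP; split => w /=;
  by rewrite ger0_norm ?expR_ge0 // lee_fin ler_expR.
under eq_integral do rewrite abse_EFin ger0_norm ?expR_ge0 //.
move=> h; have := le_trans h hB.
by rewrite expRN EFinM lee_pdivlMr ?expR_gt0 // muleC.
Qed.

Lemma integral_expR_rows_le m n (X : 'I_m -> 'I_n -> T -> R) (u : 'I_n -> R)
    (a b : R) :
  (forall i j, measurable_fun setT (X i j)) ->
  mutually_independent P (fun p : 'I_m * 'I_n => X p.1 p.2) ->
  (forall i, \int[P]_w (expR (a * (\sum_j u j * X i j w) ^+ 2))%:E <= (expR b)%:E)%E ->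
  (\int[P]_w (expR (a * \sum_i (\sum_j u j * X i j w) ^+ 2))%:E <=
   (expR (m%:R * b))%:E)%E.
Proof.
move=> mX indX hb.
have mZ i : measurable_fun setT (fun w => \sum_j u j * X i j w).
  by apply: measurable_sum => j; apply: measurable_funM => //; exact: measurable_cst.
have mF : measurable_fun setT (fun x : R => expR (a * x ^+ 2)).
  apply: (measurableT_comp (@measurable_expR R)).
  by apply: measurable_funM => //; exact: measurable_funX.
under eq_integral do rewrite mulr_sumr expR_sum.
rewrite (@integral_prod_independent _ T R P _ (fun i w => \sum_j u j * X i j w)
  (fun _ x => expR (a * x ^+ 2)) mZ (independent_rows u mX indX)) //.
have -> : ((expR (m%:R * b))%:E = \prod_(i < m) (expR b)%:E)%E.
  by rewrite prodEFin prodr_const card_ord -expRM_natl.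
(* Nonnegativity is carried along because extended real inequalities are multiplied factor by
   factor. *)
suff [] : (0 <= \prod_(i < m) \int[P]_w (expR (a * (\sum_j u j * X i j w) ^+ 2))%:E)%E /\
   (\prod_(i < m) \int[P]_w (expR (a * (\sum_j u j * X i j w) ^+ 2))%:E <=
     \prod_(i < m) (expR b)%:E)%E by [].
apply: (big_ind2 (fun x y : \bar R => (0 <= x)%E /\ (x <= y)%E)) => //.
  by move=> x1 x2 y1 y2 [x10 x12] [y10 y12]; rewrite mule_ge0 // lee_pmul.
move=> i _; split; last exact: hb.
by apply: integral_ge0 => w _; rewrite lee_fin expR_ge0.
Qed.

Lemma dot_rand_mx m n (X : 'I_m -> 'I_n -> T -> R) (u : 'cV[R]_n) w :
  dot (rand_mx X w *m u) (rand_mx X w *m u) = \sum_i (\sum_j u j 0 * X i j w) ^+ 2.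
Proof.
rewrite dotE; apply: eq_bigr => i _; rewrite -expr2; congr (_ ^+ 2).
by rewrite mxE; apply: eq_bigr => j _; rewrite mxE mulrC.
Qed.

Lemma measurable_sum_sqr_rows m n (X : 'I_m -> 'I_n -> T -> R) (u : 'I_n -> R) :
  (forall i j, measurable_fun setT (X i j)) ->
  measurable_fun setT (fun w => \sum_i (\sum_j u j * X i j w) ^+ 2).
Proof.
move=> mX; apply: measurable_sum => i; apply: measurable_funX.
by apply: measurable_sum => j; apply: measurable_funM => //; exact: measurable_cst.
Qed.

Lemma gaussian_concentration m n (X : 'I_m -> 'I_n -> T -> R) (u : 'cV[R]_n) (t : R) :
  (0 < m)%N -> (forall i j, measurable_fun setT (X i j)) ->
  (forall i j (B : set R), measurable B ->
     P (X i j @^-1` B) = normal_prob 0 (Num.sqrt (m%:R^-1)) B) ->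
  mutually_independent P (fun p : 'I_m * 'I_n => X p.1 p.2) ->
  dot u u = 1 -> 0 < t <= 1 ->
  (P [set w | (t < `|dot (rand_mx X w *m u) (rand_mx X w *m u) - 1|)%R] <=
   (2 * expR (- (t ^+ 2 * m%:R / 1024)))%:E)%E.
Proof.
move=> m0 mX lawX indX uu /andP[t0 t1].
have mR : 0 < m%:R :> R by rewrite ltr0n.
pose sigma : R := Num.sqrt m%:R^-1.
have sg0 : 0 < sigma by rewrite sqrtr_gt0 invr_gt0.
have sgE a : a / sigma ^+ 2 = a * m%:R by rewrite sqr_sqrtr ?invr_ge0 ?ler0n // invrK.
pose v j := u j 0.
have v1 : \sum_j v j ^+ 2 = 1 by rewrite -uu dotE; apply: eq_bigr => j _; rewrite expr2.
pose q w := \sum_i (\sum_j v j * X i j w) ^+ 2.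
have qE w : dot (rand_mx X w *m u) (rand_mx X w *m u) = q w by exact: dot_rand_mx.
have mq : measurable_fun setT q by exact: measurable_sum_sqr_rows.
(* This [s] minimizes [256 s^2 - s t], the exponent per row in both tails, with value
   [- t^2 / 1024]. *)
pose s : R := t / 512.
have s08 : 0 <= s <= 1 / 8 by rewrite /s; lra.
have s02 : 0 <= s < 1 / 2 by rewrite /s; lra.
have s04 : 0 <= s <= 1 / 4 by rewrite /s; lra.
have up : (\int[P]_w (expR (s * m%:R * q w))%:E <= (expR (m%:R * (s + 256 * s ^+ 2)))%:E)%E.
  apply: integral_expR_rows_le => // i; rewrite -sgE.
  rewrite (integral_expR_sqr_gaussian_sum (mX i) (independent_row i indX) sg0 (lawX i) v1 s02).
  rewrite lee_fin (le_trans (inv_sqrt_le s04)) // ler_expR lerD2l.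
  by rewrite ler_wpM2r ?sqr_ge0 //; lra.
have dn : (\int[P]_w (expR (- s * m%:R * q w))%:E <= (expR (m%:R * (- s + 256 * s ^+ 2)))%:E)%E.
  apply: integral_expR_rows_le => // i; rewrite -sgE.
  exact: (integral_expRN_sqr_gaussian_sum (mX i) (independent_row i indX) sg0 (lawX i) v1 s08).
have mup a : measurable_fun setT (fun w => a * m%:R * q w).
  by apply: measurable_funM => //; exact: measurable_cst.
pose U := [set w | s * m%:R * (1 + t) <= s * m%:R * q w].
pose L := [set w | - s * m%:R * (1 - t) <= - s * m%:R * q w].
have PU : (P U <= (expR (- (t ^+ 2 * m%:R / 1024)))%:E)%E.
  have := exponential_markov (s * m%:R * (1 + t)) (mup s) up.
  by rewrite -expRD (_ : m%:R * _ + _ = - (t ^+ 2 * m%:R / 1024)) //; rewrite /s; field.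
have PL : (P L <= (expR (- (t ^+ 2 * m%:R / 1024)))%:E)%E.
  have := exponential_markov (- s * m%:R * (1 - t)) (mup (- s)) dn.
  by rewrite -expRD (_ : m%:R * _ + _ = - (t ^+ 2 * m%:R / 1024)) //; rewrite /s; field.
have mge (f : T -> R) a : measurable_fun setT f -> measurable [set w | a <= f w].
  move=> mf; have -> : [set w | a <= f w] = setT `&` f @^-1` `[a, +oo[%classic.
    by rewrite setTI; apply/seteqP; split => w /=; rewrite in_itv /= andbT.
  exact: mf.
have mU : measurable U by exact: mge.
have mL : measurable L by exact: mge.
have mS : measurable [set w | t < `|q w - 1|].
  have -> : [set w | t < `|q w - 1|] =
      setT `&` (fun w => `|q w - 1|) @^-1` `]t, +oo[%classic.
    by rewrite setTI; apply/seteqP; split => w /=; rewrite in_itv /= andbT.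
  suff : measurable_fun setT (fun w => `|q w - 1|) by exact.
  by apply: measurableT_comp => //; exact: measurable_funB.
under eq_set do rewrite qE.
apply: (@le_trans _ _ (P (U `|` L))).
  apply: le_measure; rewrite ?inE //; first exact: measurableU.
  move=> w /=; rewrite lter_normr => /orP[h|h]; [left|right]; rewrite /U /L /=.
    by rewrite ler_wpM2l; [lra| |lra]; rewrite mulr_ge0 ?ler0n //; lra.
  by rewrite !mulNr lerN2 ler_wpM2l; [|rewrite mulr_ge0 ?ler0n //; lra|lra].
apply: (le_trans (measureU2 _ _ _)) => //.
by rewrite mulr_natl mulr2n EFinD leeD.
Qed.

Lemma measurable_rand_mx_deviation m n (X : 'I_m -> 'I_n -> T -> R) (u : 'cV[R]_n) (t : R) :
  (forall i j, measurable_fun setT (X i j)) ->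
  measurable [set w | t * dot u u <
    `|dot (rand_mx X w *m u) (rand_mx X w *m u) - dot u u|].
Proof.
move=> mX.
pose q w := \sum_i (\sum_j u j 0 * X i j w) ^+ 2.
have qE w : dot (rand_mx X w *m u) (rand_mx X w *m u) = q w by exact: dot_rand_mx.
have mq : measurable_fun setT q by exact: measurable_sum_sqr_rows.
under eq_set do rewrite qE.
have -> : [set w | t * dot u u < `|q w - dot u u|] =
    setT `&` (fun w => `|q w - dot u u|) @^-1` `]t * dot u u, +oo[%classic.
  by rewrite setTI; apply/seteqP; split => w /=; rewrite in_itv /= andbT.
suff : measurable_fun setT (fun w => `|q w - dot u u|) by exact.
by apply: measurableT_comp => //; exact: measurable_funB.
Qed.

(** By homogeneity this is the unit vector case; at [u = 0] the strict inequality makes the event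
    empty. *)
Lemma gaussian_deviation_le m n (X : 'I_m -> 'I_n -> T -> R) (u : 'cV[R]_n) (t : R) :
  (0 < m)%N -> (forall i j, measurable_fun setT (X i j)) ->
  (forall i j (B : set R), measurable B ->
     P (X i j @^-1` B) = normal_prob 0 (Num.sqrt (m%:R^-1)) B) ->
  mutually_independent P (fun p : 'I_m * 'I_n => X p.1 p.2) -> 0 < t <= 1 ->
  (P [set w | (t * dot u u <
      `|dot (rand_mx X w *m u) (rand_mx X w *m u) - dot u u|)%R] <=
   (2 * expR (- (t ^+ 2 * m%:R / 1024)))%:E)%E.
Proof.
move=> m0 mX lawX indX t01; have [u0|un0] := eqVneq (dot u u) 0.
  rewrite (_ : [set w | _] = set0).
    by rewrite measure0 lee_fin mulr_ge0 ?expR_ge0.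
  apply/seteqP; split => // w /=.
  by rewrite (dot_eq0 u0) mulmx0 /dot !mulmx0 !mxE mulr0 subrr normr0 ltxx.
have u_gt0 : 0 < dot u u by rewrite lt0r un0 dot_ge0.
pose a := Num.sqrt (dot u u).
have a0 : 0 < a by rewrite sqrtr_gt0.
have aa : a ^+ 2 = dot u u by rewrite sqr_sqrtr ?dot_ge0.
have e1 : dot (a^-1 *: u) (a^-1 *: u) = 1.
  by rewrite dotZl dotZr -aa; field; rewrite gt_eqF.
have := gaussian_concentration m0 mX lawX indX e1 t01.
rewrite (_ : [set w | (t < _)%R] = [set w | (t * dot u u <
      `|dot (rand_mx X w *m u) (rand_mx X w *m u) - dot u u|)%R]) //.
apply: eq_set => w; rewrite -scalemxAr dotZl dotZr mulrA -invfM -expr2 aa.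
set Q := dot (_ *m _) _.
have -> : (dot u u)^-1 * Q - 1 = (Q - dot u u) / dot u u by field.
by rewrite normrM normfV (gtr0_norm u_gt0) ltr_pdivlMr.
Qed.

End gaussian.

(** * Union bound over the pieces *)

Section test_vectors.
Variable R : realType.

Definition support_basis n (J : {set 'I_n}) : 'M[R]_(n, #|J|) :=
  \matrix_(i, t) (i == enum_val t)%:R.

Lemma support_basisK n (J : {set 'I_n}) (v : 'cV[R]_n) :
  (forall i, i \notin J -> v i 0 = 0) ->
  support_basis J *m (\col_t v (enum_val t) 0) = v.
Proof.
move=> vJ; apply/colP => i; rewrite mxE.
have [iJ|iJ] := boolP (i \in J); last first.
  rewrite vJ // big1 // => t _; rewrite !mxE; case: eqP => [it|_]; last by rewrite mul0r.
  by move: iJ; rewrite it enum_valP.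
rewrite (bigD1 (enum_rank_in iJ i)) //= !mxE enum_rankK_in // eqxx mul1r.
rewrite big1 ?addr0 // => t ti; rewrite !mxE; case: eqP => [it|_]; last by rewrite mul0r.
by case/eqP: ti; apply: enum_val_inj; rewrite enum_rankK_in.
Qed.

(* [G z - G z' + v] lies in the span of the two linear parts, the difference of the
   two offsets and the coordinate vectors of the support of [v]. *)
Lemma test_vectors_exist k n l d c0 (G : 'cV[R]_k -> 'cV[R]_n) :
  (0 < l)%N -> is_relu_net d c0 G ->
  exists L : seq 'cV[R]_n,
    (size L <= (((c0.+1 ^ k) ^ d.-1) * ((c0.+1 ^ k) ^ d.-1)) *
       #|[set J : {set 'I_n} | (#|J| <= 4 * l)%N]%SET| * 2 ^ (126 * (k + l)))%N /\
    forall m (A : 'M[R]_(m, n)) (t : R), 0 <= t ->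
      (forall y, y \in L -> `|dot (A *m y) (A *m y) - dot y y| <= t * dot y y) ->
      forall z z' v, (l0norm v <= 4 * l)%N ->
        let u := G z - G z' + v in
        `|dot (A *m u) (A *m u) - dot u u| <= 2 * t * dot u u.
Proof.
move=> l0 [N [dN [wN GN]]].
have [s ss hs] := relu_net_pieces 1%:M 0 wN; rewrite dN in ss.
pose spans (x : ('M[R]_(n, k) * 'cV[R]_n) * ('M[R]_(n, k) * 'cV[R]_n) * {set 'I_n}) :=
  row_mx (row_mx x.1.1.1 x.1.2.1) (row_mx (x.1.1.2 - x.1.2.2) (support_basis x.2)).
pose Q x := projT1 (cid (partial_isometry_range (spans x))).
have HQ x : Q x *m (Q x)^T *m Q x = Q x /\ Q x *m (Q x)^T *m spans x = spans x.
  exact: (projT2 (cid (partial_isometry_range (spans x)))).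
pose Ls := [seq (p, J) | p <- [seq (p, q) | p <- s, q <- s],
  J <- enum [set J : {set 'I_n} | (#|J| <= 4 * l)%N]%SET].
exists (flatten [seq [seq Q x *m y | y <- grid R _] | x <- Ls]); split.
  apply: (@leq_trans (size Ls * 2 ^ (126 * (k + l)))); last first.
    by rewrite leq_mul2r; apply/orP; right; rewrite !size_allpairs -cardE !leq_mul.
  have : forall x, x \in Ls -> (#|x.2| <= 4 * l)%N.
    move=> x /allpairsP[[p J] [_ /=]]; rewrite mem_enum inE => Jl ->; exact: Jl.
  elim: (Ls) => //= x xs IH hx; rewrite size_cat mulSn leq_add //; last first.
    by apply: IH => y yx; apply: hx; rewrite inE yx orbT.
  (* The span has [2 k + 1 + #|J| <= 2 k + 1 + 4 l] columns, at most [7 (k + l)] as [l > 0], and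
     [126 = 18 * 7]. *)
  rewrite size_map (leq_trans (size_grid _ _)) // leq_exp2l //.
  have := hx x (mem_head _ _); lia.
move=> m A t t0 hL z z' v vl /=.
have [p ps pE] := hs z; have [q qs qE] := hs z'.
pose J := [set i | v i 0 != 0]%SET.
have JL : J \in enum [set J : {set 'I_n} | (#|J| <= 4 * l)%N]%SET.
  by rewrite mem_enum inE -l0normE.
have vJ : support_basis J *m (\col_t v (enum_val t) 0) = v.
  by apply: support_basisK => i; rewrite inE negbK => /eqP.
pose x := (p, q, J).
have xL : x \in Ls.
  by apply/allpairsP; exists ((p, q), J); split => //; apply/allpairsP; exists (p, q).
have uE : G z - G z' + v = spans x *m
    col_mx (col_mx z (- z')) (col_mx 1%:M (\col_t v (enum_val t) 0)).
  rewrite /spans !mul_row_col /= vJ mulmx1 mulmxN !GN.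
  move: pE qE; rewrite !mul1mx !addr0 => -> ->.
  by apply/colP => i; rewrite !mxE; ring.
have [QQ QB] := HQ x.
apply: (near_isometry_of_grid QQ t0).
  by move=> y yQ; apply: hL; apply/flatten_mapP; exists x.
by rewrite uE mulmxA QB.
Qed.

End test_vectors.

Section union_bound.
Context d (T : measurableType d) (R : realType) (P : probability T R).

Lemma union_bound (I : eqType) (L : seq I) (bad : I -> set T) (B : R) :
  (forall y, measurable (bad y)) -> (forall y, P (bad y) <= B%:E)%E ->
  let E := [set w | forall y, y \in L -> ~ bad y w] in
  measurable E /\ ((1 - (size L)%:R * B)%:E <= P E)%E.
Proof.
move=> mbad Pbad /=; set E := [set w | _].
suff [mE PE] : measurable E /\ (P (~` E) <= ((size L)%:R * B)%:E)%E.
  split => //; have := probability_setC P (measurableC mE).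
  by rewrite setCK => ->; rewrite EFinB leeB.
rewrite /E; elim: L {E} => [|y L [mE IH]] /=.
  have -> : [set w | forall y, y \in [::] -> ~ bad y w] = setT.
    by apply/seteqP; split.
  by rewrite setCT measure0 mul0r.
set E := [set w | _] in mE IH.
have -> : [set w | forall y0, y0 \in y :: L -> ~ bad y0 w] = ~` bad y `&` E.
  apply/seteqP; split => w.
    by move=> h; split => [|z zL]; apply: h; rewrite inE ?eqxx ?zL ?orbT.
  by move=> [h1 h2] z; rewrite inE => /orP[/eqP ->|/h2].
split; first by apply: measurableI => //; exact: measurableC.
rewrite setCI setCK -natr1 addrC mulrDl mul1r EFinD.
apply: (le_trans (measureU2 _ _ _)) => //; first exact: measurableC.
by apply: leeD; [exact: Pbad|exact: IH].
Qed.

End union_bound.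

(** * Size of the union bound and choice of constants *)

Lemma ln2_ge (R : realType) : 1 / 2 <= ln (2 : R).
Proof.
rewrite -ler_expR lnK ?posrE // -[leRHS]invrK -(invrK (expR _)) -expRN.
rewrite lef_pV2 ?posrE ?invr_gt0 ?expR_gt0 //.
by have := expR_ge1Dx (- (1 / 2) : R); lra.
Qed.

(** With [a = (k + l) d ln c0], the exponents of [a] are 1 for the leading factor 2 (from the
    two-sided tail), 4 for the two networks, 2 for the summand [l] of the support count, and 126 for
    the grids: 133 in all. *)
Lemma test_vectors_count (R : realType) (k n l d c0 : nat) :
  (2 <= c0)%N -> (0 < l <= n)%N -> (0 < d)%N ->
  let H : R := (k + l)%:R * d%:R * ln c0%:R + (k + l)%:R * ln (n%:R / l%:R) in
  0 < H /\
  2 * ((((c0.+1 ^ k) ^ d.-1) * ((c0.+1 ^ k) ^ d.-1)) *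
       #|[set J : {set 'I_n} | (#|J| <= 4 * l)%N]%SET| * 2 ^ (126 * (k + l)))%N%:R
    <= expR (133 * H).
Proof.
move=> c2 lln d0 /=; have /andP[l0 ln_] := lln.
have lR : 1 <= l%:R :> R by rewrite ler1n.
have dR : 1 <= d%:R :> R by rewrite ler1n.
have kR : 0 <= k%:R :> R by rewrite ler0n.
have lnc : ln 2 <= ln c0%:R :> R.
  by rewrite ler_ln ?posrE ?ltr0n ?(leq_trans _ c2) // ler_nat.
have l2 := ln2_ge R.
have lnnl : 0 <= ln (n%:R / l%:R) :> R.
  by rewrite ln_ge0 // ler_pdivlMr ?mul1r ?ler_nat // ltr0n.
set b := ln (n%:R / l%:R) in lnnl *; set c := ln c0%:R in lnc *.
pose a : R := (k%:R + l%:R) * d%:R * c.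
have dc : ln 2 <= d%:R * c by rewrite -[leLHS]mul1r; apply: ler_pM => //; lra.
have a_ge : (k%:R + l%:R) * ln 2 <= a.
  by rewrite /a -mulrA ler_wpM2l // addr_ge0 // (le_trans _ lR).
have la : l%:R <= 2 * a.
  have : l%:R * (1 / 2) <= (k%:R + l%:R) * ln 2 :> R by apply: ler_pM => //; lra.
  lra.
have kda : k%:R * d%:R * c <= a.
  by rewrite /a -!mulrA ler_wpM2r ?lerDl ?(le_trans _ lR) //; lra.
have lb : l%:R * b <= (k%:R + l%:R) * b by rewrite ler_wpM2r // lerDr.
have klb : 0 <= (k%:R + l%:R) * b by rewrite mulr_ge0 // addr_ge0 // (le_trans _ lR).
rewrite natrD -/a; split; first by lra.
have c0R : 0 < c0%:R :> R by rewrite ltr0n (leq_trans _ c2).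
have N1 : (((c0.+1 ^ k) ^ d.-1)%N%:R <= expR (2 * (k%:R * d%:R * c)) :> R).
  apply: (@le_trans _ _ (c0 ^ (2 * (k * d)))%N%:R).
    rewrite ler_nat -expnM; apply: (@leq_trans ((c0 ^ 2) ^ (k * d.-1))%N).
      (* [c0 + 1 <= c0^2] uses [c0 >= 2]. *)
      by apply: leq_exp2rW; rewrite expnS expn1; nia.
    by rewrite -expnM leq_exp2l // !leq_mul2l leq_pred !orbT.
  rewrite natrX -[X in X ^+ _](@lnK _ c0%:R) ?posrE // -expRM_natl ler_expR !natrM -/c.
  by rewrite -!mulrA.
have N2 : (2 ^ (126 * (k + l)))%N%:R <= expR (126 * a).
  rewrite natrX -[X in X ^+ _](@lnK _ 2) ?posrE // -expRM_natl ler_expR natrM natrD.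
  by rewrite -mulrA ler_wpM2l.
have N3 := sparse_supports_le R lln.
have N0 : 2 <= expR a.
  rewrite -[leLHS](@lnK _ 2) ?posrE // ler_expR (le_trans _ a_ge) //.
  by rewrite -[leLHS]mul1r ler_wpM2r //; lra.
rewrite !natrM.
apply: (@le_trans _ _ (expR a * (expR (2 * (k%:R * d%:R * c)) *
   expR (2 * (k%:R * d%:R * c)) * expR (4 * l%:R * b + l%:R) * expR (126 * a)))).
  by repeat (apply: ler_pM; rewrite ?mulr_ge0 ?ler0n //).
by rewrite -!expRD ler_expR; lra.
Qed.

Theorem theorem2 (R : realType) :
  exists C c : R, 0 < C /\ 0 < c /\
  forall (k n d c0 : nat) (G : 'cV[R]_k -> 'cV[R]_n),
    (2 <= c0)%N -> is_relu_net d c0 G ->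
  forall alpha : R, 0 < alpha < 1 ->
  forall l : nat, (0 < l <= n)%N ->
  forall eps_max delta : R, 0 <= eps_max -> 0 <= delta ->
  forall m : nat,
    C / alpha ^+ 2 * ((k + l)%:R * d%:R * ln c0%:R + (k + l)%:R * ln (n%:R / l%:R))
      <= m%:R ->
  forall (dT : measure_display) (T : measurableType dT)
         (P : probability T R)
         (X : 'I_m -> 'I_n -> T -> R),
    (forall i j, measurable_fun setT (X i j)) ->
    (forall i j (B : set R), measurable B ->
        P (X i j @^-1` B) = normal_prob 0 (Num.sqrt (m%:R^-1)) B) ->
    mutually_independent P (fun p : 'I_m * 'I_n => X p.1 p.2) ->
  exists E : set T, measurable E /\
    ((1 - expR (- (c * alpha ^+ 2 * m%:R)))%:E <= P E)%E /\
    forall w, E w ->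
      exists Delta : 'cV[R]_m -> 'cV[R]_n,
      forall (x : 'cV[R]_n) (eps : 'cV[R]_m),
        l2norm eps <= eps_max ->
        l2norm (x - Delta (rand_mx X w *m x + eps))
          <= (Num.sqrt (2 * l%:R))^-1
               * (2 * ((1 + alpha) / (1 - alpha) + 1)) * sigma_lG l G x
             + 2 / (1 - alpha) * eps_max
             + delta / (1 - alpha).
Proof.
have C0 : 0 < 8192 * 133 :> R by lra.
(* The tail exponent at level [alpha / 2] is [alpha^2 m / 4096]. Half of it pays for the [e^(133 H)]
   of the union bound and half remains as the failure probability. *)
exists (8192 * 133), (1 / 8192); split; first exact: C0.
split; first by lra.
move=> k n d c0 G c2 netG alpha alpha01 l lln em delta em0 delta0 m hm dT T P X mX lawX indX.
have /andP[al0 al1] := alpha01; have /andP[l0 _] := lln.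
have d0 : (0 < d)%N by case: netG => N [<- _]; exact: net_depth_gt0.
have [H0 Hcount] := test_vectors_count R k c2 lln d0.
set H := (_ + _ : R) in H0 Hcount hm.
have [L [Lsize Lgood]] := test_vectors_exist l0 netG.
have al2 : 0 < alpha ^+ 2 by rewrite exprn_gt0.
have Hm : 8192 * 133 * H <= alpha ^+ 2 * m%:R.
  by rewrite -(ler_pdivrMl _ _ al2) mulrA [_^-1 * _]mulrC.
have m0 : (0 < m)%N.
  by rewrite -(ltr0n R); exact: lt_le_trans (mulr_gt0 (divr_gt0 C0 al2) H0) hm.
(* Passing from the grid to whole subspaces doubles the level. *)
pose t := alpha / 2.
have t01 : 0 < t <= 1 by rewrite /t; lra.
pose bad (y : 'cV[R]_n) := [set w | t * dot y y <
  `|dot (rand_mx X w *m y) (rand_mx X w *m y) - dot y y|].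
pose B : R := 2 * expR (- (t ^+ 2 * m%:R / 1024)).
have [mE PE] := @union_bound _ T R P _ L bad B
  (fun y => measurable_rand_mx_deviation y t mX)
  (fun y => gaussian_deviation_le y m0 mX lawX indX t01).
exists [set w | forall y, y \in L -> ~ bad y w]; split => //; split.
  apply: le_trans PE; rewrite lee_fin lerD2l lerN2.
  have LR : 2 * (size L)%:R <= expR (133 * H).
    by apply: le_trans Hcount; rewrite ler_wpM2l // ler_nat.
  rewrite /B mulrA [(size L)%:R * 2]mulrC.
  apply: le_trans (ler_wpM2r (expR_ge0 _) LR) _.
  rewrite -expRD ler_expR /t exprMn exprVn; lra.
move=> w Ew.
have t0 : 0 <= t by have /andP[/ltW] := t01.
have iso : forall z z' v, (l0norm v <= 4 * l)%N ->
    let u := G z - G z' + v in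
    `|dot (rand_mx X w *m u) (rand_mx X w *m u) - dot u u| <= alpha * dot u u.
  have -> : alpha = 2 * t by rewrite /t; field.
  apply: Lgood => // y yL; rewrite leNgt; apply/negP; exact: Ew.
have inst := instance_optimality alpha01 l0 iso.
set a := _ * (_ + 1) in inst.
have al1' : 0 <= 1 - alpha by rewrite subr_ge0 ltW.
have a0 : 0 <= a.
  by rewrite mulr_ge0 ?invr_ge0 ?sqrtr_ge0 // addr_ge0 // divr_ge0 // addr_ge0 // ltW.
have b0 : 0 <= (1 - alpha)^-1 by rewrite invr_ge0.
have [Delta HD] := decoder_exists em a0 b0 (@sigma_lipschitz _ _ _ l G) inst.
exists Delta => x eps he; apply: le_trans (HD x eps he) _.
rewrite -[leLHS]addr0; apply: lerD; last by rewrite mulr_ge0.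
rewrite le_eqVlt; apply/orP; left; apply/eqP.
by rewrite /a; congr (_ + _); rewrite !mulrA; congr (_ * _); ring.
Qed.
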